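(* For every $l\in\mathbb{Z}$ there is a non-empty Euclidean open subset of the space of $4\times 4$ Markov matrices all of whose elements $M$ are embeddable Markov matrices for which $\mathrm{Log}_l(M)$ is defined and is the unique Markov generator of $M$. In particular, there is a non-empty Euclidean open subset of the space of $4\times 4$ Markov matrices all of whose elements are embeddable and have a principal logarithm that is not a rate matrix.
   Context: A real square matrix is a Markov matrix if its entries are non-negative and each of its rows sums to $1$. A real square matrix $Q$ is a rate matrix if its off-diagonal entries are non-negative and each of its rows sums to $0$. A Markov matrix $M$ is embeddable if $M=e^Q$ for some rate matrix $Q$; any such rate matrix $Q$ is called a Markov generator of $M$. The space of $4\times 4$ Markov matrices carries the Euclidean (subspace) topology, as a subset of the $12$-dimensional affine space of real $4\times 4$ matrices whose rows sum to $1$. For $z\in\mathbb{C}\setminus\{0\}$ let $\mathrm{Arg}(z)\in(-\pi,\pi]$ be the principal argument, and for $k\in\mathbb{Z}$ put $\log_k(z)=\log|z|+(\mathrm{Arg}(z)+2\pi k)\,i$. Let $M$ be a $4\times4$ Markov matrix that can be diagonalized as $M=P\,\mathrm{diag}(1,\lambda,\mu,\overline{\mu})\,P^{-1}$ with $\lambda\in(0,1)$ and $\mu\in\mathbb{C}\setminus\mathbb{R}$, $\mathrm{Arg}(\mu)>0$. For such $M$ and $k\in\mathbb{Z}$ define $$\mathrm{Log}_k(M):=P\,\mathrm{diag}\big(0,\log(\lambda),\log_k(\mu),\overline{\log_k(\mu)}\big)\,P^{-1},$$ which does not depend on the choice of $P$. For any other $M$, $\mathrm{Log}_k(M)$ is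 not defined. The principal logarithm of a matrix $M$ with no negative or null eigenvalues is the unique matrix $Q$ with $e^Q=M$ whose eigenvalues are the principal logarithms $\log_0$ of the eigenvalues of $M$; for a $4\times4$ Markov matrix $M$ that can be diagonalized as $M=P\,\mathrm{diag}(1,\lambda,\mu,\overline{\mu})\,P^{-1}$ with $\lambda\in(0,1)$ and $\mu\in\mathbb{C}\setminus\mathbb{R}$, $\mathrm{Arg}(\mu)>0$, it equals $\mathrm{Log}_0(M)$. *)

(* Defs.v *)
From HB Require Import structures.
From mathcomp Require Import all_boot all_order all_algebra.
From mathcomp Require Import complex.
From mathcomp Require Import all_classical all_reals all_analysis.

Set Implicit Arguments.
Unset Strict Implicit.
Unset Printing Implicit Defensive.

Import Order.TTheory GRing.Theory Num.Theory.
Import numFieldNormedType.Exports.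

Local Open Scope classical_set_scope.
Local Open Scope complex_scope.
Local Open Scope ring_scope.

Definition expm (K : numFieldType) (n : nat) (A : 'M[K]_n) : 'M[K]_n :=
  limn (series (fun k : nat => k`!%:R^-1 *: A ^+ k)).

Definition markov_matrix (R : realType) (n : nat) : set 'M[R]_n :=
  [set M | (forall i j, 0 <= M i j) /\ (forall i, \sum_j M i j = 1)].

Definition rate_matrix (R : realType) (n : nat) : set 'M[R]_n :=
  [set Q | (forall i j, i != j -> 0 <= Q i j) /\ (forall i, \sum_j Q i j = 0)].

Definition markov_generator (R : realType) (n : nat) (M : 'M[R]_n) :
    set 'M[R]_n :=
  [set Q | rate_matrix Q /\ expm Q = M].

Definition embeddable (R : realType) (n : nat) : set 'M[R]_n :=
  [set M | markov_matrix M /\ exists Q, markov_generator M Q].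

(* Relative openness: the topology of ['M[R]_n] given by its norm [mx_norm] is
   the Euclidean one, and Markov matrices have empty interior in ['M[R]_n]. *)
Definition markov_open (R : realType) (n : nat) (U : set 'M[R]_n) : Prop :=
  exists2 V : set 'M[R]_n, open V & U = V `&` @markov_matrix R n.

Definition mxC (R : realType) (m n : nat) (A : 'M[R]_(m, n)) :
    'M[R[i]]_(m, n) :=
  map_mx (fun x : R => x%:C) A.

(* [acos] takes its values in [[0, pi]]; see [ArgP]. *)
Definition Arg (R : realType) (z : R[i]) : R :=
  let t := acos (complex.Re z / complex.Re `|z|) in
  if 0 <= complex.Im z then t else - t.

Definition logk (R : realType) (k : int) (z : R[i]) : R[i] :=
  (ln (complex.Re `|z|)) +i* (Arg z + 2 * pi * k%:~R).

Definition diag4 (R : realType) (a b c d : R[i]) : 'M[R[i]]_4 :=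
  diag_mx (\row_(j < 4) [:: a; b; c; d]`_j).

Definition Log_diagonalization (R : realType) (M : 'M[R]_4)
    (P : 'M[R[i]]_4) (lam : R) (mu : R[i]) : Prop :=
  [/\ P \in unitmx,
      0 < lam < 1,
      complex.Im mu != 0,
      0 < Arg mu &
      mxC M = P *m diag4 1 lam%:C mu (conjc mu) *m invmx P].

Definition Log_defined (R : realType) (M : 'M[R]_4) : Prop :=
  markov_matrix M /\ exists P lam mu, Log_diagonalization M P lam mu.

Definition Log_of (R : realType) (k : int)
    (P : 'M[R[i]]_4) (lam : R) (mu : R[i]) : 'M[R[i]]_4 :=
  P *m diag4 0 (ln lam)%:C (logk k mu) (conjc (logk k mu)) *m invmx P.

(* The set below has at most one element, see [Log_ofE]; it is meant to be
   used only under [Log_defined M]. *)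
Definition Log (R : realType) (k : int) (M : 'M[R]_4) : 'M[R[i]]_4 :=
  xget 0 [set L | exists P lam mu,
            Log_diagonalization M P lam mu /\ L = Log_of k P lam mu].

(* In the order of [R[i]], [z <= 0] means that [z] is real and nonpositive. *)
Definition principal_log (R : realType) (n : nat) (M : 'M[R[i]]_n) :
    set 'M[R[i]]_n :=
  [set Q | (forall z, eigenvalue M z -> ~~ (z <= 0)) /\
     unique (fun L : 'M[R[i]]_n => expm L = M /\
       (forall w, eigenvalue L w <->
          exists2 z, eigenvalue M z & w = logk 0 z)) Q].

Lemma ArgP (R : realType) (z : R[i]) : z != 0 ->
  - pi < Arg z <= pi /\
  z = `|z| * (cos (Arg z) +i* sin (Arg z)).
Proof.
case: z => a b z0.
rewrite /Arg; set r := complex.Re `|_| => /=.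
have rE : `|a +i* b| = r%:C by [].
have r2 : r ^+ 2 = a ^+ 2 + b ^+ 2.
  by rewrite /r /= sqr_sqrtr// addr_ge0// sqr_ge0.
have r_ge0 : 0 <= r by rewrite /r sqrtr_ge0.
have r_gt0 : 0 < r.
  rewrite lt_def r_ge0 andbT; apply: contra z0 => /eqP r0.
  by rewrite -normr_eq0 rE r0.
have rn0 : r != 0 by rewrite gt_eqF.
have ar1 : `|a / r| <= 1.
  rewrite normrM normfV (gtr0_norm r_gt0) ler_pdivrMr// mul1r.
  by rewrite -ler_sqr ?nnegrE// real_normK ?num_real// r2 lerDl sqr_ge0.
have /andP[arl aru] : -1 <= a / r <= 1 by rewrite -ler_norml.
have ar : a / r \in `[(-1), 1] by rewrite in_itv /= arl aru.
have t_ge0 : 0 <= acos (a / r) by rewrite acos_ge0// arl aru.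
have t_lepi : acos (a / r) <= pi by rewrite acos_lepi// arl aru.
have ct : cos (acos (a / r)) = a / r by rewrite acosK.
have st : sin (acos (a / r)) = `|b| / r.
  rewrite sin_acos ?arl ?aru// -[RHS]ger0_norm ?divr_ge0// -sqrtr_sqr.
  congr Num.sqrt; apply: (mulIf (expf_neq0 2 rn0)).
  by rewrite mulrBl mul1r -!exprMn !divfK// r2 addrC addKr real_normK// num_real.
have pi0 := pi_gt0 R.
case: (leP 0 b) => b0; split.
- by rewrite t_lepi andbT (lt_le_trans _ t_ge0)// oppr_lt0.
- rewrite rE ct st (ger0_norm b0); simpc.
  by congr (_ +i* _); rewrite mulrC divfK.
- suff : acos (a / r) != pi.
    move=> tpi; rewrite ltrN2 lt_neqAle tpi t_lepi /=.
    by rewrite (le_trans _ (ltW pi0))// oppr_le0.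
  apply/eqP => tpi; move: st; rewrite tpi sinpi => /esym/eqP.
  by rewrite mulf_eq0 invr_eq0 (negPf rn0) orbF normr_eq0 lt_eqF.
- rewrite rE cosN sinN ct st (ltr0_norm b0) mulNr opprK; simpc.
  by congr (_ +i* _); rewrite mulrC divfK.
Qed.

Lemma Log_ofE (R : realType) (k : int) (M : 'M[R]_4) P lam mu :
  Log_diagonalization M P lam mu -> Log k M = Log_of k P lam mu.
Proof.
pose f (z : R[i]) : R[i] :=
  if complex.Im z == 0 then (ln (complex.Re z))%:C
  else if 0 < Arg z then logk k z else conjc (logk k (conjc z)).
have ArgJ (z : R[i]) : complex.Im z != 0 -> 0 < Arg z -> (0 < Arg (conjc z)) = false.
  case: z => a b /= b0; rewrite /Arg; have [bp|bn] := leP 0 (complex.Im (a +i* b)).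
    have b_gt0 : 0 < b by rewrite lt_def b0.
    move=> t0; rewrite /= oppr_ge0 leNgt b_gt0 /= sqrrN.
    by apply/negbTE; rewrite -leNgt oppr_le0; exact: ltW.
  rewrite oppr_gt0 /= => tn.
  by rewrite oppr_ge0 (ltW bn) /= sqrrN; apply/negbTE; rewrite -leNgt ltW.
have fE lam' (mu' : R[i]) : complex.Im mu' != 0 -> 0 < Arg mu' ->
    forall j : 'I_4, [:: 0; (ln lam')%:C; logk k mu'; conjc (logk k mu')]`_j
      = f [:: 1; lam'%:C; mu'; conjc mu']`_j.
  move=> m0 Am [[|[|[|[|//]]]] lt_j4] /=; rewrite /f /=.
  - by rewrite eqxx ln1.
  - by rewrite eqxx.
  - by rewrite (negPf m0) Am.
  - have -> : complex.Im (conjc mu') == 0 = false.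
      by case: (mu') m0 => a b /=; rewrite oppr_eq0 => /negbTE.
    by rewrite ArgJ// conjcK.
move=> MP; rewrite /Log; case: xgetP => [_ -> [P' [lam' [mu' [MP' ->]]]]|]; last first.
  by move=> /(_ (Log_of k P lam mu)) []; exists P, lam, mu.
case: MP MP' => Pu _ m0 Am MP [P'u _ m0' Am' MP'].
pose S := invmx P' *m P.
have SD : S *m diag4 1 lam%:C mu (conjc mu) = diag4 1 lam'%:C mu' (conjc mu') *m S.
  have : P *m diag4 1 lam%:C mu (conjc mu) *m invmx P =
         P' *m diag4 1 lam'%:C mu' (conjc mu') *m invmx P' by rewrite -MP -MP'.
  move=> /(congr1 (fun X => invmx P' *m X *m P)).
  by rewrite !mulmxA mulVmx// mul1mx mulmxKV.
suff SL : S *m diag4 0 (ln lam)%:C (logk k mu) (conjc (logk k mu)) =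
          diag4 0 (ln lam')%:C (logk k mu') (conjc (logk k mu')) *m S.
  move: SL => /(congr1 (fun X => P' *m X *m invmx P)).
  rewrite /S /Log_of !mulmxA mulmxV// mul1mx => ->.
  by rewrite -!mulmxA mulmxV// mulmx1.
clearbody S; apply/matrixP => i j; move/matrixP: SD => /(_ i j).
rewrite /diag4 !(mul_mx_diag, mul_diag_mx) !mxE !fE//.
have [->|Sij] := eqVneq (S i j) 0; first by rewrite !mul0r !mulr0.
by rewrite mulrC => /(mulIf Sij) ->; rewrite mulrC.
Qed.

(* Main.v *)
Require Import Defs.
From HB Require Import structures.
From mathcomp Require Import all_boot all_order all_algebra.
From mathcomp Require Import complex ring lra zify.
From mathcomp Require Import all_classical all_reals all_analysis.

Set Implicit Arguments.
Unset Strict Implicit.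
Unset Printing Implicit Defensive.

Import Order.TTheory GRing.Theory Num.Theory.
Import numFieldNormedType.Exports.

Local Open Scope classical_set_scope.
Local Open Scope complex_scope.
Local Open Scope ring_scope.


(** Let M be a Markov matrix with eigenvalues 1, lam in ]0, 1[ and a pair
    a +- i b with b > 0. As the eigenvalues are distinct, every matrix commuting
    with M is diagonal in an eigenbasis of M, so the real logarithms of M are
    exactly the matrices Log_k(M) for integers k, and
    Log_k(M) = Log_l(M) + 2 pi (k - l) V, where V is the real matrix acting as 0
    on the eigenvectors of 1 and lam and as i and -i on the other two
    ([real_log_is_log_poly], [log_polyB]). Hence if Q = Log_l(M) has positive
    entries off the diagonal and both Q + 2 pi V and Q - 2 pi V have a negative
    one, then Q is the only Markov generator of M ([unique_markov_generator]).

    These are finitely many strict inequalities, so they survive a small change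
    of M among the matrices with row sums 1 ([near_isolated_log]). Indeed lam
    stays a simple real root of the characteristic polynomial, hence moves
    continuously by the intermediate value theorem; the trace and the
    determinant then give a and b, and Q and V are polynomials in M whose
    coefficients depend continuously on lam, a and b.

    It remains to satisfy the inequalities at one matrix for each l
    ([exists_isolated_log]). The rate matrix Q0 of the directed 4-cycle with
    rates 1, 5, 1, 5 has eigenvalues 0, -6 and -3 +- i, and its V has entries -1
    and +1 at two places where Q0 vanishes, because the rates alternate. If E is
    the projection on the stationary distribution, then t Q0 + 3 (E - 1) has
    positive entries off the diagonal, and its entries at those two places,
    which are 5/4 and 1/4 whatever t is, are smaller than 2 pi. The pair of
    eigenvalues has imaginary parts t and -t, so t = |pi / 2 + 2 pi l| makes
    it the l-th logarithm of its exponential.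

    For l <> 0 the principal logarithm Log_0(M) is another real logarithm of M,
    so it is not a rate matrix. *)

(** * Entrywise limits of matrices *)

(** The neighbourhoods of a matrix are by definition generated by the products
    of neighbourhoods of its entries, whence the equivalence. *)
Lemma cvg_mxP (K : numFieldType) (m n : nat) (T : Type) (F : set_system T)
    (FF : Filter F) (f : T -> 'M[K]_(m, n)) (A : 'M[K]_(m, n)) :
  f @ F --> A <-> forall i j, (fun x => f x i j) @ F --> A i j.
Proof.
split=> [fA i j P PA|fA P [Q QA QP]].
  have := fA [set N : 'M[K]_(m, n) | P (N i j)].
  apply; exists (fun k l => [set z | k = i /\ l = j -> P z]).
    move=> k l; rewrite -/(nbhs (A k l) _).
    have [->|ki] := eqVneq k i; have [->|lj] := eqVneq l j.
    - by apply: (@filterS _ (nbhs (A i j)) _ P) => // z Pz _.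
    - apply: (@filterS _ (nbhs (A _ _)) _ setT); last exact: filterT.
      by move=> z _ [_ e]; rewrite e eqxx in lj.
    - apply: (@filterS _ (nbhs (A _ _)) _ setT); last exact: filterT.
      by move=> z _ [e]; rewrite e eqxx in ki.
    - apply: (@filterS _ (nbhs (A _ _)) _ setT); last exact: filterT.
      by move=> z _ [e]; rewrite e eqxx in ki.
  by move=> N /(_ i j) /=; apply.
suff : F [set x | forall i j, Q i j (f x i j)].
  by move=> h; apply: (@filterS _ F FF _ _ _ h) => x Qx; exact: QP.
apply: filter_forall => i; apply: filter_forall => j.
by apply: (fA i j); exact: QA.
Qed.

Section mx_cvg.
Context {K : numFieldType} {T : Type} {F : set_system T} {FF : Filter F}.

Lemma cvg_sum (I : Type) (r : seq I) (f : I -> T -> K) (a : I -> K) :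
  (forall i, f i @ F --> a i) ->
  (fun x => \sum_(i <- r) f i x) @ F --> \sum_(i <- r) a i.
Proof.
move=> fa; elim: r => [|i r IH].
  by rewrite big_nil; under eq_fun do rewrite big_nil; exact: cvg_cst.
rewrite big_cons; under eq_fun do rewrite big_cons.
by apply: cvgD => //; exact: fa.
Qed.

Lemma cvg_prod (I : Type) (r : seq I) (f : I -> T -> K) (a : I -> K) :
  (forall i, f i @ F --> a i) ->
  (fun x => \prod_(i <- r) f i x) @ F --> \prod_(i <- r) a i.
Proof.
move=> fa; elim: r => [|i r IH].
  by rewrite big_nil; under eq_fun do rewrite big_nil; exact: cvg_cst.
rewrite big_cons; under eq_fun do rewrite big_cons.
by apply: cvgM => //; exact: fa.
Qed.

Lemma cvg_mulmx (m n p : nat) (f : T -> 'M[K]_(m, n)) (g : T -> 'M[K]_(n, p))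
    (A : 'M[K]_(m, n)) (B : 'M[K]_(n, p)) :
  f @ F --> A -> g @ F --> B -> (fun x => f x *m g x) @ F --> A *m B.
Proof.
move=> /cvg_mxP fA /cvg_mxP gB; apply/cvg_mxP => i j; rewrite mxE.
under eq_fun do rewrite mxE.
by apply: cvg_sum => k; apply: cvgM; [exact: fA|exact: gB].
Qed.

Lemma cvg_det (n : nat) (f : T -> 'M[K]_n) (A : 'M[K]_n) :
  f @ F --> A -> (fun x => \det (f x)) @ F --> \det A.
Proof.
move=> /cvg_mxP fA; rewrite /determinant.
apply: cvg_sum => s.
by apply: cvgM; [exact: cvg_cst|apply: cvg_prod => i; exact: fA].
Qed.

Lemma cvg_mxtrace (n : nat) (f : T -> 'M[K]_n) (A : 'M[K]_n) :
  f @ F --> A -> (fun x => \tr (f x)) @ F --> \tr A.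
Proof. by move=> /cvg_mxP fA; apply: cvg_sum => i; exact: fA. Qed.

End mx_cvg.

Lemma cvg_mx_unique (K : numFieldType) (m n : nat) (u : nat -> 'M[K]_(m, n))
    (A B : 'M[K]_(m, n)) :
  u @ \oo --> A -> u @ \oo --> B -> A = B.
Proof.
move=> /cvg_mxP uA /cvg_mxP uB; apply/matrixP => i j.
exact: (cvg_unique _ (uA i j) (uB i j)).
Qed.

Lemma expm_cvgE (K : numFieldType) (n : nat) (A M : 'M[K]_n) :
  series (fun k : nat => k`!%:R^-1 *: A ^+ k) @ \oo --> M -> expm A = M.
Proof.
by move=> h; have hl := cvgP _ h; exact: cvg_mx_unique hl h.
Qed.

(** The limit of a divergent sequence is by convention the default matrix 0, so
    a nonzero value of [expm] witnesses the convergence of the series. *)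
Lemma expm_cvg (K : numFieldType) (n : nat) (A M : 'M[K]_n) :
  expm A = M -> M != 0 ->
  series (fun k : nat => k`!%:R^-1 *: A ^+ k) @ \oo --> M.
Proof.
move=> <- A0.
have [//|dv] := pselect (cvgn (series (fun k : nat => k`!%:R^-1 *: A ^+ k))).
have A00 : expm A = 0.
  by rewrite /expm dvgP//; apply/matrixP => i j; rewrite !mxE.
by rewrite A00 eqxx in A0.
Qed.

(** The partial sums are polynomials in A. *)
Lemma expm_comm (K : numFieldType) (n : nat) (A M : 'M[K]_n) :
  series (fun k : nat => k`!%:R^-1 *: A ^+ k) @ \oo --> M -> A *m M = M *m A.
Proof.
set s := series _ => h.
have c k : A *m s k = s k *m A.
  rewrite /s /series /= mulmx_sumr mulmx_suml; apply: eq_bigr => i _.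
  rewrite -scalemxAr -scalemxAl; congr (_ *: _).
  exact: (GRing.commrX i (erefl (A * A))).
apply: (@cvg_mx_unique _ _ _ (fun k => A *m s k)).
  by apply: cvg_mulmx => //; exact: cvg_cst.
by under eq_fun do rewrite c; apply: cvg_mulmx => //; exact: cvg_cst.
Qed.

(** * The complex exponential series *)

Definition exp_sum (K : numFieldType) (n : nat) (z : K) : K :=
  \sum_(0 <= k < n) k`!%:R^-1 * z ^+ k.

(** The defect of the partial sums from being multiplicative is a polynomial
    with nonnegative coefficients in z and w; hence its modulus at (z, w) is at
    most its value at (|z|, |w|). *)
Lemma exp_sum_mulB (K : numFieldType) (n : nat) (z w : K) :
  exp_sum n z * exp_sum n w - exp_sum n (z + w) =
  \sum_(0 <= i < n) \sum_(n - i <= j < n)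
     (i`!%:R^-1 * z ^+ i) * (j`!%:R^-1 * w ^+ j).
Proof.
pose F i j : K := (i`!%:R^-1 * z ^+ i) * (j`!%:R^-1 * w ^+ j).
have f0 k : (k`!%:R : K) != 0 by rewrite pnatr_eq0 -lt0n fact_gt0.
have -> : exp_sum n (z + w) = \sum_(0 <= i < n) \sum_(0 <= j < n - i) F i j.
  transitivity (\sum_(0 <= k < n) \sum_(0 <= i < n | (i <= k)%N) F i (k - i)%N).
    apply: eq_big_nat => k /andP[_ kn].
    rewrite addrC exprDn mulr_sumr -(big_mkord xpredT (fun i =>
      k`!%:R^-1 * (w ^+ (k - i) * z ^+ i *+ 'C(k, i)))) (big_nat_widen _ _ n)//.
    apply: eq_big => [i|i]; rewrite /= ltnS // => ik.
    rewrite /F -mulr_natl -(bin_fact ik) !natrM !invfM.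
    have c0 : ('C(k, i)%:R : K) != 0 by rewrite pnatr_eq0 -lt0n bin_gt0.
    by field; rewrite c0 !f0.
  rewrite (exchange_big_dep_nat xpredT)//=; apply: eq_big_nat => i /andP[_ ile].
  rewrite -(big_nat_widenl i 0 n xpredT)// -{1}[ i]add0n big_addn.
  by apply: eq_bigr => j _; rewrite addnK.
rewrite /exp_sum mulr_suml -sumrB; apply: eq_big_nat => i /andP[_ ile].
rewrite mulr_sumr (big_cat_nat (n := n - i))//= ?leq_subr//.
by rewrite addrAC /F subrr add0r.
Qed.

(** The topology of R[i] comes with its [numFieldType] structure. *)
Local Notation Cx R := (Num.NumField.sort (R[i] : numFieldType)).

Lemma cvg_real_complex (R : realType) (T : Type) (F : set_system T)
    (FF : Filter F) (f : T -> R) (a : R) :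
  f @ F --> a -> (fun x => (f x)%:C : Cx R) @ F --> (a%:C : Cx R).
Proof.
move=> /cvgrPdist_lt fa; apply/cvgrPdist_lt => e.
(* in R[i], [0 < e] forces e to be real *)
case: e => e ei; rewrite ltcE /= => /andP[/eqP -> e0].
by apply: filterS (fa _ e0) => x; rewrite -rmorphB normc_def /= expr0n addr0
  sqrtr_sqr ltcR.
Qed.

Lemma normc_le_Re (R : realType) (z : R[i]) : (`|complex.Re z|)%:C <= `|z|.
Proof.
case: z => a b; rewrite normc_def lecR /= -sqrtr_sqr ler_wsqrtr//.
by rewrite lerDl sqr_ge0.
Qed.

Lemma cvg_complex_Re (R : realType) (T : Type) (F : set_system T)
    (FF : Filter F) (f : T -> Cx R) (z : Cx R) :
  f @ F --> z -> (fun x => complex.Re (f x)) @ F --> complex.Re z.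
Proof.
move=> /cvgrPdist_lt fa; apply/cvgrPdist_lt => e e0.
have e0C : 0 < (e%:C : R[i]) by rewrite ltcR.
apply: filterS (fa _ e0C) => x h.
rewrite -ltcR; apply: le_lt_trans h; apply: le_trans (normc_le_Re _).
by rewrite raddfB.
Qed.

Lemma cvg_complex (R : realType) (T : Type) (F : set_system T)
    (FF : Filter F) (f g : T -> R) (a b : R) :
  f @ F --> a -> g @ F --> b ->
  (fun x => (f x +i* g x) : Cx R) @ F --> (a +i* b : Cx R).
Proof.
move=> fa gb.
have E (x y : R) : x +i* y = x%:C + 'i * y%:C by simpc.
rewrite E; under eq_fun do rewrite E.
apply: cvgD; first exact: cvg_real_complex.
by apply: cvgM; [exact: cvg_cst|exact: cvg_real_complex].
Qed.

Definition cexp (R : realType) (z : R[i]) : R[i] :=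
  (expR (complex.Re z))%:C * (cos (complex.Im z) +i* sin (complex.Im z)).

Lemma exp_sum_real (R : realType) (n : nat) (x : R) :
  exp_sum n (x%:C : R[i]) = (exp_sum n x)%:C.
Proof.
rewrite rmorph_sum; apply: eq_bigr => k _.
by rewrite rmorphM rmorphXn fmorphV rmorph_nat.
Qed.

Lemma exp_sum_cvg (R : realType) (x : R) :
  (fun n => exp_sum n x) @ \oo --> expR x.
Proof.
have -> : (fun n => exp_sum n x) = series (exp_coeff x).
  by apply/funext => n; apply: eq_bigr => k _; rewrite mulrC.
exact: is_cvg_series_exp_coeff.
Qed.

Lemma exp_sum_imaginary (R : realType) (n : nat) (y : R) :
  exp_sum n ('i * y%:C : R[i]) =
  series (cos_coeff y) n +i* series (sin_coeff y) n.
Proof.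
rewrite /series /=; elim: n => [|n IH].
  by rewrite /exp_sum !big_geq.
rewrite /exp_sum in IH *; rewrite !big_nat_recr//= IH.
rewrite /cos_coeff /sin_coeff /=.
suff -> : n`!%:R^-1 * ('i * y%:C) ^+ n =
   ((~~ odd n)%:R * (-1) ^ n./2 * y ^+ n / n`!%:R) +i*
   ((odd n)%:R * (-1) ^+ n.-1./2 * y ^+ n / n`!%:R) by simpc.
have i2 : 'i * 'i = - 1 :> R[i] by rewrite -expr2 sqr_i.
rewrite exprMn -rmorphXn -(rmorph_nat (real_complex R)) -fmorphV.
have -> : ('i : R[i]) ^+ n =
    ((~~ odd n)%:R * (-1) ^+ n./2) +i* ((odd n)%:R * (-1) ^+ n.-1./2).
  rewrite -{1}(odd_double_half n) exprD -mul2n exprM sqr_i.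
  rewrite -[-1 : R[i]](rmorphN1 (real_complex R)) -rmorphXn /=.
  have [on|on] := boolP (odd n) => /=.
    have -> : (n.-1./2 = n./2)%N.
      by rewrite -{1}[n]odd_double_half on /= doubleK.
    rewrite expr1.
    by simpc.
  by rewrite expr0; simpc.
by simpc; congr (_ +i* _); rewrite mulrC.
Qed.

(** For z = x + i y the partial sums at x converge to exp x and those at i y to
    cos y + i sin y. That the partial sums at z approach their product follows
    from [exp_sum_mulB]: the difference is dominated by the same difference for
    |x| and |y|, which tends to exp |x| exp |y| - exp (|x| + |y|) = 0. *)
Lemma exp_sum_cvg_complex (R : realType) (z : R[i]) :
  (fun n => exp_sum n z : Cx R) @ \oo --> (cexp z : Cx R).
Proof.
case: z => x y.
have -> : x +i* y = x%:C + 'i * y%:C by simpc.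
have -> : cexp (x%:C + 'i * y%:C) = (expR x)%:C * (cos y +i* sin y).
  by rewrite /cexp /=; simpc.
pose p n : Cx R := exp_sum n (x%:C : R[i]) * exp_sum n ('i * y%:C : R[i]).
have pl : p @ \oo --> ((expR x)%:C * (cos y +i* sin y) : Cx R).
  apply: cvgM.
    under eq_fun do rewrite exp_sum_real.
    by apply: cvg_real_complex; exact: exp_sum_cvg.
  under eq_fun do rewrite exp_sum_imaginary; apply: cvg_complex.
    by rewrite cos.unlock; exact: is_cvg_series_cos_coeff.
  by rewrite sin.unlock; exact: is_cvg_series_sin_coeff.
pose q (n : nat) : R := exp_sum n `|x| * exp_sum n `|y| - exp_sum n (`|x| + `|y|).
have q0 : q @ \oo --> (0 : R).
  rewrite -(subrr (expR (`|x| + `|y|))) {1}expRD.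
  by apply: cvgB; [apply: cvgM|]; exact: exp_sum_cvg.
have pq n : `|exp_sum n (x%:C + 'i * y%:C : R[i]) - p n| <= (q n)%:C.
  rewrite distrC /p /q exp_sum_mulB exp_sum_mulB rmorph_sum.
  apply: le_trans (ler_norm_sum _ _ _) _; apply: ler_sum => i _.
  rewrite rmorph_sum; apply: le_trans (ler_norm_sum _ _ _) _.
  apply: ler_sum => j _.
  have nx : `|x%:C : R[i]| = `|x|%:C.
    by rewrite normc_def /= expr0n addr0 sqrtr_sqr.
  have ny : `|'i * y%:C : R[i]| = `|y|%:C.
    rewrite normc_def; simpc => /=.
    by rewrite expr0n add0r sqrtr_sqr.
  rewrite !normrM !normrX !normfV !normr_nat nx ny.
  by rewrite !rmorphM !fmorphV !rmorph_nat !rmorphXn.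
apply/cvgrPdist_lt => e e0.
move: q0 => /cvg_real_complex /cvgrPdist_lt /(_ (e / 2)) q0.
move: pl => /cvgrPdist_lt /(_ (e / 2)) pl.
near=> n.
have h1 : `|(expR x)%:C * (cos y +i* sin y) - p n| < e / 2.
  by near: n; apply: pl; rewrite divr_gt0.
have h2 : `|(0:R)%:C - (q n)%:C| < e / 2.
  by near: n; apply: q0; rewrite divr_gt0.
rewrite [e]splitr (le_lt_trans (ler_distD (p n) _ _))// ltrD//.
rewrite distrC; apply: le_lt_trans (pq n) _; apply: le_lt_trans h2.
by rewrite sub0r normrN normc_def /= expr0n addr0 sqrtr_sqr lecR ler_norm.
Unshelve. all: by end_near. Qed.

(** * Exponentials and logarithms of diagonalizable matrices *)

Lemma exp_series_diagonalizable (R : realType) (n : nat) (P : 'M[R[i]]_n)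
    (d : 'rV[R[i]]_n) : P \in unitmx ->
  series (fun k : nat =>
    k`!%:R^-1 *: (P *m diag_mx d *m invmx P) ^+ k : 'M[Cx R]_n) @ \oo
  --> (P *m diag_mx (\row_j cexp (d 0 j)) *m invmx P : 'M[Cx R]_n).
Proof.
move=> Pu.
have Xk k : (P *m diag_mx d *m invmx P) ^+ k =
    P *m diag_mx (\row_j (d 0 j) ^+ k) *m invmx P.
  elim: k => [|k IH].
    rewrite expr0 (_ : \row_j _ = const_mx 1) ?diag_const_mx ?mulmx1 ?mulmxV//.
    by apply/matrixP => i j; rewrite !mxE.
  rewrite exprS IH -[_ * _]/(_ *m _) !mulmxA mulmxKV// -(mulmxA P) mulmx_diag.
  by congr (_ *m diag_mx _ *m _); apply/matrixP => i j; rewrite !mxE exprS.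
have -> : series (fun k : nat => k`!%:R^-1 *: (P *m diag_mx d *m invmx P) ^+ k) =
    fun N => P *m diag_mx (\row_j exp_sum N (d 0 j)) *m invmx P.
  apply/funext => N; rewrite /series /= /exp_sum; elim: N => [|N IH].
    rewrite big_geq// (_ : \row_j _ = 0) ?raddf0 ?mulmx0 ?mul0mx//.
    by apply/matrixP => i j; rewrite !mxE big_geq.
  rewrite big_nat_recr//= IH Xk scalemxAl scalemxAr -mulmxDl -mulmxDr.
  congr (_ *m _ *m _); apply/matrixP => i j; rewrite !mxE.
  by rewrite big_nat_recr//= mulrnDl mulrnAr.
apply: cvg_mulmx; last exact: cvg_cst.
apply: cvg_mulmx; first exact: cvg_cst.
apply/cvg_mxP => i j; rewrite mxE; under eq_fun do rewrite mxE.
apply: cvgMn; rewrite mxE; under eq_fun do rewrite mxE.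
exact: exp_sum_cvg_complex.
Qed.

Lemma expm_diagonalizable (R : realType) (n : nat) (P : 'M[R[i]]_n)
    (d : 'rV[R[i]]_n) : P \in unitmx ->
  expm (P *m diag_mx d *m invmx P) =
  P *m diag_mx (\row_j cexp (d 0 j)) *m invmx P.
Proof.
move=> Pu; apply: (@expm_cvgE (R[i] : numFieldType)).
exact: exp_series_diagonalizable.
Qed.

Lemma mxCE (R : realType) (m n : nat) (A : 'M[R]_(m, n)) :
  mxC A = map_mx (real_complex R) A.
Proof. by []. Qed.

Lemma mxC_exp_series (R : realType) (n N : nat) (A : 'M[R]_n) :
  mxC (series (fun k : nat => k`!%:R^-1 *: A ^+ k) N) =
  series (fun k : nat => k`!%:R^-1 *: mxC A ^+ k) N.
Proof.
rewrite /series /= !mxCE raddf_sum; apply: eq_bigr => k _.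
rewrite /= map_mxZ fmorphV rmorph_nat; congr (_ *: _).
elim: k => [|k IH]; first by rewrite !expr0 map_mx1.
by rewrite !exprS -IH -[_ * _]/(_ *m _) map_mxM.
Qed.

(** As the modulus dominates the real part, the convergence of an exponential
    series over C implies that of the real series it comes from. *)
Lemma cvg_mxC (R : realType) (T : Type) (F : set_system T) (FF : Filter F)
    (m n : nat) (f : T -> 'M[R]_(m, n)) (A : 'M[R]_(m, n)) :
  (fun x => mxC (f x) : 'M[Cx R]_(m, n)) @ F --> (mxC A : 'M[Cx R]_(m, n)) <->
  f @ F --> A.
Proof.
split=> /cvg_mxP fA; apply/cvg_mxP => i j; last first.
  by rewrite mxE; under eq_fun do rewrite mxE; exact: cvg_real_complex.
have := fA i j; rewrite mxE; under eq_fun do rewrite mxE.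
by move=> /cvg_complex_Re.
Qed.

(** The exponential of a real matrix is computed in a complex eigenbasis. *)
Lemma expm_real (R : realType) (n : nat) (A M : 'M[R]_n) (P : 'M[R[i]]_n)
    (d : 'rV[R[i]]_n) : P \in unitmx ->
  mxC A = P *m diag_mx d *m invmx P ->
  mxC M = P *m diag_mx (\row_j cexp (d 0 j)) *m invmx P -> expm A = M.
Proof.
move=> Pu AP MP; apply: expm_cvgE; apply/cvg_mxC.
under eq_fun do rewrite mxC_exp_series.
by rewrite AP MP; exact: exp_series_diagonalizable.
Qed.

Lemma cosDz2pi (R : realType) (x : R) (k : int) :
  cos (x + 2 * pi * k%:~R) = cos x /\ sin (x + 2 * pi * k%:~R) = sin x.
Proof.
have E (n : nat) (y : R) :
    cos (y + 2 * pi * n%:R) = cos y /\ sin (y + 2 * pi * n%:R) = sin y.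
  have -> : 2 * pi * n%:R = (pi *+ 2) *+ n :> R.
    by rewrite -[RHS]mulr_natr mulr_natl.
  by rewrite (periodicn (@cosD2pi R)) (periodicn (@sinD2pi R)).
case: k => n; first exact: E.
rewrite NegzE rmorphN mulrN /= -[in RHS](subrK (2 * pi * n.+1%:R) x).
rewrite -[in X in _ /\ _ = X](subrK (2 * pi * n.+1%:R) x).
by have [-> ->] := E n.+1 (x - 2 * pi * n.+1%:R).
Qed.

(** With k the integer nearest to (x - y) / (2 pi), the remainder z lies in
    [-pi, pi] and cos z = 1; the cosine being injective on [0, pi], z = 0. *)
Lemma cos_sin_eq (R : realType) (x y : R) : cos x = cos y -> sin x = sin y ->
  exists k : int, x = y + 2 * pi * k%:~R.
Proof.
move=> cxy sxy; have pi0 := pi_gt0 R.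
pose k := Num.floor ((x - y + pi) / (2 * pi)); exists k.
pose z := x - y - 2 * pi * k%:~R.
have cz : cos `|z| = cos 0.
  have -> : cos `|z| = cos z by have [h|h] := ger0P z; rewrite ?cosN.
  rewrite /z -mulrN -rmorphN; have [-> _] := cosDz2pi (x - y) (- k).
  rewrite cosD cosN sinN cxy sxy cos0 mulrN opprK -!expr2.
  exact: cos2Dsin2.
have zpi : `|z| <= pi.
  have := Num.Theory.floor_itv ((x - y + pi) / (2 * pi)); rewrite -/k => /andP[].
  rewrite ler_pdivlMr ?mulr_gt0// ltr_pdivrMr ?mulr_gt0// intrD => h1 h2.
  rewrite ler_norml /z; apply/andP; split; lra.
have : `|z| = 0.
  apply: (@cos_inj R) => //; rewrite in_itv /= ?normr_ge0 ?lexx ?zpi//.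
  by rewrite ltW.
by move=> /eqP; rewrite normr_eq0 /z => /eqP; lra.
Qed.

(** The branches [logk k w] are all the logarithms of w: the modulus determines
    the real part, and the argument the imaginary part modulo 2 pi. *)
Lemma cexp_eqP (R : realType) (z w : R[i]) : w != 0 ->
  cexp z = w <-> exists k : int, z = logk k w.
Proof.
move=> w0; have [_ wE] := ArgP w0.
have wr : `|w| = (complex.Re `|w|)%:C by case: (w) => a b.
have r0 : 0 < complex.Re `|w| by rewrite -ltcR -wr normr_gt0.
split=> [ezw|[k ->]].
  have [rE cE] : expR (complex.Re z) = complex.Re `|w| /\
     cos (complex.Im z) +i* sin (complex.Im z) = cos (Arg w) +i* sin (Arg w).
    have nE : expR (complex.Re z) = complex.Re `|w|.
      rewrite -ezw /cexp normrM !normc_def /= expr0n addr0 sqrtr_sqr.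
      by rewrite cos2Dsin2 sqrtr1 ger0_norm ?expR_ge0// mulr0 subr0 mulr1.
    split => //; move: ezw; rewrite [in RHS]wE /cexp nE wr => /mulfI; apply.
    by rewrite -wr normr_eq0.
  case: cE => c s; have [k kE] := cos_sin_eq c s; exists k.
  by rewrite /logk -rE expRK -kE; case: (z).
rewrite /cexp /logk /= lnK ?posrE//; have [-> ->] := cosDz2pi (Arg w) k.
by rewrite -wr.
Qed.

Lemma cexp_real_inj (R : realType) (z : R[i]) (x : R) : 0 < x ->
  conjc z = z -> cexp z = x%:C -> z = (ln x)%:C.
Proof.
case: z => a b x0 [] /eqP; rewrite eq_sym -addr_eq0 -mulr2n mulrn_eq0 /= => /eqP b0.
rewrite /cexp /= b0 cos0 sin0; simpc => -[<-].
by rewrite expRK.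
Qed.

Lemma cexp_conj (R : realType) (z : R[i]) : cexp (conjc z) = conjc (cexp z).
Proof. by case: z => a b; rewrite /cexp /= cosN sinN; simpc. Qed.

Lemma cexp_ln (R : realType) (x : R) : 0 < x -> cexp (ln x)%:C = x%:C.
Proof. by move=> x0; rewrite /cexp /= lnK ?posrE// cos0 sin0; simpc. Qed.

(** * Matrices with distinct eigenvalues *)

(** Left eigenvectors of distinct eigenvalues are independent: from a relation
    u S = 0 between the rows of S, the product of the X - D_i over i <> j,
    evaluated at M, isolates the j-th term. *)
Lemma diagonalize_distinct (F : fieldType) (n : nat) (M : 'M[F]_n.+1)
    (D : 'rV[F]_n.+1) :
  (forall i j, D 0 i = D 0 j -> i = j) -> (forall j, root (char_poly M) (D 0 j)) ->
  exists2 P, P \in unitmx & M = P *m diag_mx D *m invmx P.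
Proof.
move=> Dinj Droot.
have /fin_all_exists2[v vM v0] (j : 'I_n.+1) :
    exists2 v : 'rV_n.+1, v *m M = D 0 j *: v & v != 0.
  by apply/eigenvalueP; rewrite eigenvalue_root_char.
pose S := \matrix_(j < n.+1) v j.
have SM : S *m M = diag_mx D *m S.
  apply/row_matrixP => j; rewrite row_mul rowK vM.
  by apply/rowP => k; rewrite mul_diag_mx !mxE.
have Sp p : S *m horner_mx M p = horner_mx (diag_mx D) p *m S.
  elim/poly_ind: p => [|p c IH]; first by rewrite !rmorph0 mulmx0 mul0mx.
  rewrite !rmorphD !rmorphM /= !horner_mx_X !horner_mx_C -![_ * _]/(_ *m _).
  by rewrite mulmxDr mulmxDl mulmxA IH -!mulmxA SM scalar_mxC.
have Su : S \in unitmx.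
  rewrite -row_free_unit; apply/inj_row_free => u uS; apply/rowP => j.
  pose p := \prod_(i < n.+1 | i != j) ('X - (D 0 i)%:P).
  have pD i : p.[D 0 i] = if i == j then p.[D 0 j] else 0.
    have [->//|ij] := eqVneq i j.
    by rewrite /p horner_prod (bigD1 i)//= !hornerE subrr mul0r.
  have pj0 : p.[D 0 j] != 0.
    rewrite horner_prod; apply/prodf_neq0 => i ij; rewrite !hornerE subr_eq0.
    by apply: contra ij => /eqP/Dinj ->.
  have : u *m S *m horner_mx M p = 0 by rewrite uS mul0mx.
  rewrite -mulmxA Sp horner_mx_diag mulmxA => h.
  have : (u 0 j * p.[D 0 j]) *: v j = 0.
    rewrite -{}h; apply/rowP => k; rewrite !mxE (bigD1 j)//= big1 ?addr0.
      by rewrite mul_mx_diag !mxE.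
    by move=> i ij; rewrite mul_mx_diag !mxE pD (negPf ij) mulr0 mul0r.
  move/eqP; rewrite scaler_eq0 (negPf (v0 j)) orbF mulf_eq0 (negPf pj0) orbF.
  by move=> /eqP ->; rewrite mxE.
exists (invmx S); first by rewrite unitmx_inv.
by rewrite invmxK -mulmxA -SM mulKmx.
Qed.

(** In the eigenbasis, entry (i, j) of the commutator of A and M is the entry of
    A times D_j - D_i. *)
Lemma comm_diagonalized (F : fieldType) (n : nat) (A P : 'M[F]_n) (D : 'rV[F]_n) :
  (forall i j, D 0 i = D 0 j -> i = j) -> P \in unitmx ->
  A *m (P *m diag_mx D *m invmx P) = (P *m diag_mx D *m invmx P) *m A ->
  exists d, A = P *m diag_mx d *m invmx P.
Proof.
move=> Dinj Pu AM; pose B := invmx P *m A *m P.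
have BD : B *m diag_mx D = diag_mx D *m B.
  move: AM => /(congr1 (fun X => invmx P *m X *m P)).
  by rewrite /B !mulmxA !mulmxKV// mulVmx// mul1mx.
exists (\row_j B j j).
have -> : diag_mx (\row_j B j j) = B.
  apply/matrixP => i j; rewrite !mxE; have [->|ij] := eqVneq i j; first by rewrite mulr1n.
  rewrite mulr0n; move/matrixP: BD => /(_ i j); rewrite mul_mx_diag mul_diag_mx !mxE.
  rewrite mulrC => /eqP; rewrite -subr_eq0 -mulrBl mulf_eq0 => /orP[|/eqP->//].
  by rewrite subr_eq0 => /eqP/Dinj ji; rewrite ji eqxx in ij.
by rewrite /B !mulmxA mulmxV// mul1mx mulmxK.
Qed.

(** The invertible matrix S from the basis P to its conjugate intertwines the
    diagonal matrices of conjugates with the original ones, simultaneously for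
    M and A. A nonzero entry of S in column j thus gives one index i that
    serves both matrices: conjugation pairs the eigenvalues of A as it does
    those of M. *)
Lemma diagonal_conj (R : realType) (n : nat) (M A : 'M[R]_n) (P : 'M[R[i]]_n)
    (D d : 'rV[R[i]]_n) : P \in unitmx ->
  mxC M = P *m diag_mx D *m invmx P -> mxC A = P *m diag_mx d *m invmx P ->
  forall j, exists2 i, conjc (D 0 j) = D 0 i & conjc (d 0 j) = d 0 i.
Proof.
move=> Pu MP AP j.
have Cu : map_mx (@conjc R) P \in unitmx by rewrite map_unitmx.
pose S := invmx P *m map_mx (@conjc R) P.
have key (B : 'M[R]_n) (e : 'rV[R[i]]_n) : mxC B = P *m diag_mx e *m invmx P ->
    S *m diag_mx (map_mx (@conjc R) e) = diag_mx e *m S.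
  move=> BP; have : map_mx (@conjc R) (mxC B) = mxC B.
    by apply/matrixP => k l; rewrite !mxE conjc_real.
  rewrite {1}BP !map_mxM map_invmx map_diag_mx BP.
  move=> /(congr1 (fun X => invmx P *m X *m map_mx (@conjc R) P)).
  by rewrite /S !mulmxA !mulmxKV// mulVmx// mul1mx.
have Su : S \in unitmx by rewrite unitmx_mul unitmx_inv Pu.
clearbody S; have [i Sij] : exists i, S i j != 0.
  apply/existsP; rewrite -negb_forall; apply/negP => /forallP S0.
  have : invmx S *m S = 1%:M by rewrite mulVmx.
  move=> /matrixP/(_ j j); rewrite !mxE eqxx big1 => [/eqP|k _].
    by rewrite eq_sym oner_eq0.
  by rewrite (eqP (S0 k)) mulr0.
by exists i; [move: (key _ _ MP)|move: (key _ _ AP)] => /matrixP/(_ i j);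
  rewrite mul_mx_diag mul_diag_mx !mxE mulrC => /(mulIf Sij).
Qed.

Lemma mxC_horner (R : realType) (n : nat) (M : 'M[R]_n.+1) (P : 'M[R[i]]_n.+1)
    (D : 'rV[R[i]]_n.+1) (p : {poly R}) : P \in unitmx ->
  mxC M = P *m diag_mx D *m invmx P ->
  mxC (horner_mx M p) =
  P *m diag_mx (\row_j (map_poly (real_complex R) p).[D 0 j]) *m invmx P.
Proof.
move=> Pu MP; rewrite mxCE map_horner_mx -mxCE MP horner_mx_uconj//.
congr (_ *m _ *m _); rewrite horner_mx_diag.
by congr diag_mx; apply/rowP => j; rewrite !mxE.
Qed.

Lemma horner_mx_fixed (F : fieldType) (n m : nat) (M : 'M[F]_n.+1)
    (u : 'M[F]_(n.+1, m)) (p : {poly F}) :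
  M *m u = u -> horner_mx M p *m u = p.[1] *: u.
Proof.
move=> Mu; elim/poly_ind: p => [|p c IH].
  by rewrite rmorph0 mul0mx horner0 scale0r.
rewrite rmorphD rmorphM /= horner_mx_X horner_mx_C -[_ * _]/(_ *m _).
by rewrite mulmxDl -mulmxA Mu IH mul_scalar_mx !hornerE scalerDl.
Qed.

Lemma eigenvalue_diagonalized (F : fieldType) (n : nat) (P : 'M[F]_n) (D : 'rV[F]_n) z :
  P \in unitmx ->
  eigenvalue (P *m diag_mx D *m invmx P) z <-> exists j, z = D 0 j.
Proof.
move=> Pu; split=> [/eigenvalueP[v vz v0]|[j ->]].
  have vP0 : v *m P != 0.
    by apply: contra v0 => /eqP h; rewrite -(mulmxK Pu v) h mul0mx.
  have [j vj] : exists j, (v *m P) 0 j != 0.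
    by have /rV0Pn := vP0.
  exists j; move: vz => /(congr1 (fun X => X *m P)); rewrite !mulmxA mulmxKV//.
  rewrite -scalemxAl; move: (v *m P) vj => w wj /rowP/(_ j).
  by rewrite mul_mx_diag !mxE mulrC => /(mulIf wj).
apply/eigenvalueP; exists (row j (invmx P)).
  rewrite !mulmxA -row_mul mulVmx// -row_mul mul1mx row_diag_mx -scalemxAl -rowE//.
apply/eqP => /(congr1 (fun X => X *m P)); rewrite -row_mul mulVmx// mul0mx.
by move=> /rowP/(_ j); rewrite !mxE eqxx => /eqP; rewrite oner_eq0.
Qed.

(** * The logarithms of M as polynomials in M *)

Section log_polynomial.
Variables (R : realType) (lam a b : R).
Hypotheses (lam1 : lam != 1) (b0 : b != 0).

(** Polynomials that take on the spectrum 1, lam, a + i b, a - i b the values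
    1, 0, 0, 0 ([proj1_poly]), 0, 1, 0, 0 ([projlam_poly]), 0, 0, 1, 1
    ([projpair_poly]) and 0, 0, i, -i ([rot_poly]). At M the first three give
    the real spectral projections and the last one the matrix V. *)
Definition pair_poly : {poly R} := ('X - a%:P) ^+ 2 + (b ^+ 2)%:P.
Definition proj1_poly : {poly R} :=
  ((1 - lam) * pair_poly.[1])^-1 *: (('X - lam%:P) * pair_poly).
Definition projlam_poly : {poly R} :=
  ((lam - 1) * pair_poly.[lam])^-1 *: (('X - 1%:P) * pair_poly).
Definition projpair_poly : {poly R} := 1%:P - proj1_poly - projlam_poly.
Definition rot_poly : {poly R} := b^-1 *: (('X - a%:P) * projpair_poly).

Definition spectrum4 : 'rV[R[i]]_4 :=
  \row_(j < 4) [:: 1; lam%:C; a +i* b; conjc (a +i* b)]`_j.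

Definition evalC (p : {poly R}) (z : R[i]) := (map_poly (real_complex R) p).[z].

Lemma pair_poly_gt0 x : 0 < pair_poly.[x].
Proof.
rewrite /pair_poly !hornerE ltr_wpDl ?sqr_ge0//.
by rewrite lt_def sqr_ge0 sqrf_eq0 b0.
Qed.

Lemma evalC_real p x : evalC p x%:C = (p.[x])%:C.
Proof. exact: horner_map. Qed.

Lemma evalCD p q z : evalC (p + q) z = evalC p z + evalC q z.
Proof. by rewrite /evalC rmorphD hornerD. Qed.
Lemma evalCN p z : evalC (- p) z = - evalC p z.
Proof. by rewrite /evalC rmorphN hornerN. Qed.
Lemma evalCM p q z : evalC (p * q) z = evalC p z * evalC q z.
Proof. by rewrite /evalC rmorphM hornerM. Qed.
Lemma evalCC c z : evalC c%:P z = c%:C.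
Proof. by rewrite /evalC map_polyC hornerC. Qed.
Lemma evalCX z : evalC 'X z = z.
Proof. by rewrite /evalC map_polyX hornerX. Qed.
Lemma evalCZ c p z : evalC (c *: p) z = c%:C * evalC p z.
Proof. by rewrite -mul_polyC evalCM evalCC. Qed.
Definition evalCE := (evalCD, evalCN, evalCM, evalCC, evalCX, evalCZ).

Lemma evalC_conj p z : evalC p (conjc z) = conjc (evalC p z).
Proof.
elim/poly_ind: p => [|p c IH]; first by rewrite /evalC rmorph0 !horner0 rmorph0.
by rewrite !evalCE IH rmorphD rmorphM /= oppr0.
Qed.

Lemma pair_poly_root : evalC pair_poly (a +i* b) = 0.
Proof. by rewrite /pair_poly expr2 !evalCE; simpc; congr (_ +i* _); ring. Qed.

Lemma proj1_poly_1 : proj1_poly.[1] = 1.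
Proof.
rewrite /proj1_poly hornerZ hornerM hornerXsubC mulVf// mulf_neq0//.
  by rewrite subr_eq0 eq_sym.
by rewrite gt_eqF ?pair_poly_gt0.
Qed.

Lemma proj1_poly_lam : proj1_poly.[lam] = 0.
Proof. by rewrite /proj1_poly hornerZ hornerM hornerXsubC subrr mul0r mulr0. Qed.

Lemma proj1_poly_pair : evalC proj1_poly (a +i* b) = 0.
Proof. by rewrite evalCZ evalCM pair_poly_root !mulr0. Qed.

Lemma projlam_poly_1 : projlam_poly.[1] = 0.
Proof. by rewrite /projlam_poly hornerZ hornerM hornerXsubC subrr mul0r mulr0. Qed.

Lemma projlam_poly_lam : projlam_poly.[lam] = 1.
Proof.
rewrite /projlam_poly hornerZ hornerM hornerXsubC mulVf// mulf_neq0//.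
  by rewrite subr_eq0.
by rewrite gt_eqF ?pair_poly_gt0.
Qed.

Lemma projlam_poly_pair : evalC projlam_poly (a +i* b) = 0.
Proof. by rewrite evalCZ evalCM pair_poly_root !mulr0. Qed.

Lemma projpair_poly_1 : projpair_poly.[1] = 0.
Proof. 
rewrite /projpair_poly 2!hornerD 2!hornerN hornerC proj1_poly_1 projlam_poly_1.
by rewrite subrr subr0.
Qed.

Lemma projpair_poly_lam : projpair_poly.[lam] = 0.
Proof. 
rewrite /projpair_poly 2!hornerD 2!hornerN hornerC proj1_poly_lam.
by rewrite projlam_poly_lam subr0 subrr.
Qed.

Lemma projpair_poly_pair : evalC projpair_poly (a +i* b) = 1.
Proof. 
rewrite /projpair_poly !evalCD !evalCN evalCC proj1_poly_pair projlam_poly_pair.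
by rewrite !subr0.
Qed.

Lemma rot_poly_1 : rot_poly.[1] = 0.
Proof. by rewrite /rot_poly hornerZ hornerM projpair_poly_1 !mulr0. Qed.

Lemma rot_poly_lam : rot_poly.[lam] = 0.
Proof. by rewrite /rot_poly hornerZ hornerM projpair_poly_lam !mulr0. Qed.

Lemma rot_poly_pair : evalC rot_poly (a +i* b) = 'i.
Proof.
rewrite /rot_poly evalCZ evalCM projpair_poly_pair evalCD evalCN evalCC evalCX.
by simpc; rewrite ?subrr ?mulr0 mulVf.
Qed.

Definition comb_poly (x u t : R) : {poly R} :=
  x *: projlam_poly + u *: projpair_poly + t *: rot_poly.

Lemma comb_poly_spectrum x u t : 
  (\row_j evalC (comb_poly x u t) (spectrum4 0 j)) =
  \row_(j < 4) [:: 0; x%:C; u +i* t; conjc (u +i* t)]`_j.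
Proof.
have cp : evalC (comb_poly x u t) (a +i* b) = u +i* t.
  rewrite /comb_poly 2!evalCD (evalCZ x) (evalCZ u) (evalCZ t).
  by rewrite projpair_poly_pair projlam_poly_pair rot_poly_pair; simpc.
apply/rowP => -[[|[|[|[|//]]]] lt_j4]; rewrite !mxE /=.
- rewrite -[1 : R[i]](rmorph1 (real_complex R)) evalC_real.
  rewrite /comb_poly 2!hornerD (hornerZ x) (hornerZ u) (hornerZ t).
  by rewrite projlam_poly_1 projpair_poly_1 rot_poly_1 !mulr0 !addr0.
- rewrite evalC_real /comb_poly 2!hornerD (hornerZ x) (hornerZ u) (hornerZ t).
  by rewrite projlam_poly_lam projpair_poly_lam rot_poly_lam !mulr0 !addr0 mulr1.
- exact: cp.
- by rewrite -[_ -i* _]/(conjc (a +i* b)) evalC_conj cp.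
Qed.

Lemma comb_poly_1 x u t : (comb_poly x u t).[1] = 0.
Proof. 
rewrite /comb_poly 2!hornerD (hornerZ x) (hornerZ u) (hornerZ t).
by rewrite projlam_poly_1 projpair_poly_1 rot_poly_1 !mulr0 !addr0.
Qed.

End log_polynomial.

(** At M this polynomial is Log_l(M). The argument of a + i b is an arc cosine
    because b > 0. *)
Definition log_poly (R : realType) (l : int) (lam a b : R) : {poly R} :=
  comb_poly lam a b (ln lam) (ln (Num.sqrt (a ^+ 2 + b ^+ 2)))
    (acos (a / Num.sqrt (a ^+ 2 + b ^+ 2)) + 2 * pi * l%:~R).

Lemma logk_pair (R : realType) (l : int) (a b : R) : 0 < b ->
  logk l (a +i* b) = ln (Num.sqrt (a ^+ 2 + b ^+ 2)) +i*
    (acos (a / Num.sqrt (a ^+ 2 + b ^+ 2)) + 2 * pi * l%:~R).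
Proof. by move=> b0; rewrite /logk /Arg /= (ltW b0). Qed.

Lemma Arg_pair_gt0 (R : realType) (a b : R) : 0 < b -> 0 < Arg (a +i* b).
Proof.
move=> b0; rewrite ltNge; apply/negP => A0.
have z0 : a +i* b != 0 by rewrite eq_complex /= (gt_eqF b0) andbF.
have [/andP[/ltW Api _] zE] := ArgP z0.
have s0 : sin (Arg (a +i* b)) <= 0.
  rewrite -oppr_ge0 -sinN sin_ge0_pi// oppr_ge0 A0 /=.
  by rewrite lerNl.
have /(congr1 (@complex.Im R)) := zE; rewrite normc_def; simpc => /= bE.
by move: b0; rewrite bE ltNge mulr_ge0_le0// sqrtr_ge0.
Qed.

(** * All real logarithms of one Markov matrix *)

Lemma mxC_inj (R : realType) (m n : nat) : injective (@mxC R m n).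
Proof.
move=> A B /matrixP AB; apply/matrixP => i j.
by have := AB i j; rewrite !mxE => -[].
Qed.

Lemma spectrum4_inj (R : realType) (lam a b : R) : lam < 1 -> 0 < b ->
  forall i j, spectrum4 lam a b 0 i = spectrum4 lam a b 0 j -> i = j.
Proof.
move=> lam1 b0 [[|[|[|[|//]]]] hi] [[|[|[|[|//]]]] hj]; rewrite !mxE /=;
  try (by move=> _; apply: val_inj); move=> [] *; exfalso; lra.
Qed.

Lemma log_poly_diagonal (R : realType) (l : int) (M : 'M[R]_4) P (lam a b : R) :
  0 < b -> Log_diagonalization M P lam (a +i* b) ->
  mxC (horner_mx M (log_poly l lam a b)) = Log_of l P lam (a +i* b).
Proof.
move=> b0 [Pu /andP[lam0 lam1] _ _ MP].
have l1 : lam != 1 by rewrite lt_eqF.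
have bn : b != 0 by rewrite gt_eqF.
rewrite (mxC_horner _ Pu MP) /Log_of /diag4; congr (_ *m diag_mx _ *m _).
have := comb_poly_spectrum a l1 bn (ln lam) (ln (Num.sqrt (a ^+ 2 + b ^+ 2)))
  (acos (a / Num.sqrt (a ^+ 2 + b ^+ 2)) + 2 * pi * l%:~R).
by rewrite -logk_pair.
Qed.

Lemma log_polyB (R : realType) (k l : int) (lam a b : R) :
  log_poly k lam a b = log_poly l lam a b + (2 * pi * (k - l)%:~R) *: rot_poly lam a b.
Proof.
rewrite /log_poly /comb_poly -[RHS]addrA -scalerDl; congr (_ + _ *: _).
by rewrite rmorphB /=; ring.
Qed.

(** Here V is the difference of consecutive real logarithms divided by 2 pi. As
    the conditions are strict they are open; and since Q > 0 off the diagonal,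
    a negative entry of Q + 2 pi V stays negative in Q + 2 pi m V for all
    m >= 1, so that testing the two neighbours of Q is enough. *)
Definition isolated_rate (R : realType) (n : nat) (Q V : 'M[R]_n) : Prop :=
  [/\ forall i j, i != j -> 0 < Q i j,
     exists i j, i != j /\ Q i j + 2 * pi * V i j < 0 &
     exists i j, i != j /\ Q i j - 2 * pi * V i j < 0].

Lemma logk0_real (R : realType) (x : R) : 0 < x -> logk 0 x%:C = (ln x)%:C.
Proof.
move=> x0; rewrite /logk /Arg /= lexx expr0n addr0 sqrtr_sqr gtr0_norm//.
by rewrite divff ?gt_eqF// acos1 mulr0 addr0.
Qed.

Lemma logk0_conj (R : realType) (a b : R) : 0 < b ->
  logk 0 (conjc (a +i* b)) = conjc (logk 0 (a +i* b)).
Proof.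
by move=> b0; rewrite /logk /Arg /= oppr_ge0 leNgt b0 (ltW b0) /= sqrrN mulr0 !addr0.
Qed.

Section pointwise.
Variables (R : realType) (M : 'M[R]_4) (P : 'M[R[i]]_4) (lam a b : R).
Hypotheses (Mm : markov_matrix M) (lam0 : 0 < lam) (lam1 : lam < 1) (b0 : 0 < b).
Hypothesis MP : mxC M = P *m diag_mx (spectrum4 lam a b) *m invmx P.
Hypothesis Pu : P \in unitmx.

Lemma Log_diagonalization_pair : Log_diagonalization M P lam (a +i* b).
Proof.
split=> //; [by rewrite lam0|by rewrite /= gt_eqF|exact: Arg_pair_gt0].
Qed.

Lemma markov_neq0 : M != 0.
Proof.
apply: contraPN (Mm.2 0) => /eqP ->; rewrite big1 => [/eqP|i _]; rewrite ?mxE//.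
by rewrite eq_sym oner_eq0.
Qed.

Lemma spectrum4_cexp l : spectrum4 lam a b =
  \row_j cexp ((\row_(j < 4) [:: 0; (ln lam)%:C; logk l (a +i* b);
                   conjc (logk l (a +i* b))]`_j : 'rV_4) 0 j).
Proof.
have mu0 : a +i* b != 0 by rewrite eq_complex /= (gt_eqF b0) andbF.
have emu : cexp (logk l (a +i* b)) = a +i* b by apply/(cexp_eqP _ mu0); exists l.
apply/rowP => -[[|[|[|[|//]]]] lt_j4]; rewrite !mxE.
- by rewrite -[RHS]/(cexp 0) /cexp /= expR0 cos0 sin0; simpc.
- by rewrite -[RHS]/(cexp (ln lam)%:C) cexp_ln.
- by rewrite -[RHS]/(cexp (logk l (a +i* b))) emu.
- by rewrite -[RHS]/(cexp (conjc (logk l (a +i* b)))) cexp_conj emu.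
Qed.

Lemma expm_Log_of l : expm (Log_of l P lam (a +i* b)) = mxC M.
Proof. by rewrite /Log_of /diag4 expm_diagonalizable// -spectrum4_cexp MP. Qed.

Lemma expm_log_poly l : expm (horner_mx M (log_poly l lam a b)) = M.
Proof.
apply: (expm_real Pu); first exact: log_poly_diagonal Log_diagonalization_pair.
by rewrite MP -spectrum4_cexp.
Qed.

(** A logarithm of M commutes with M, so it is diagonal in the same basis; the
    exponential is then computed entry by entry. *)
Lemma complex_log_diagonal (L : 'M[R[i]]_4) :
  series (fun k : nat => k`!%:R^-1 *: L ^+ k : 'M[Cx R]_4) @ \oo
    --> (mxC M : 'M[Cx R]_4) ->
  exists2 d, L = P *m diag_mx d *m invmx P &
    forall j, cexp (d 0 j) = spectrum4 lam a b 0 j.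
Proof.
move=> h; have LM := expm_comm h.
have [d Ld] : exists d, L = P *m diag_mx d *m invmx P.
  apply: (@comm_diagonalized _ _ L P (spectrum4 lam a b)) => //; last by rewrite -MP.
  exact: spectrum4_inj.
exists d => // j; move: h; rewrite Ld => h.
have : mxC M = P *m diag_mx (\row_j cexp (d 0 j)) *m invmx P.
  exact: cvg_mx_unique h (exp_series_diagonalizable (d := d) Pu).
rewrite MP => /(congr1 (fun X => invmx P *m X *m P)).
rewrite !mulmxA !mulmxKV// !mulVmx// !mul1mx => /matrixP/(_ j j).
by rewrite !mxE eqxx !mulr1n.
Qed.

(** By [diagonal_conj] the eigenvalues of Q belonging to 1 and lam are real, so
    they are 0 and ln lam, and those belonging to a +- i b are conjugate; only
    the branch k of the logarithm of a + i b remains free. *)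
Lemma real_log_is_log_poly (Q : 'M[R]_4) : expm Q = M ->
  exists k, Q = horner_mx M (log_poly k lam a b).
Proof.
move=> QM; have h := expm_cvg QM markov_neq0.
have [|d Qd dE] := @complex_log_diagonal (mxC Q).
  rewrite (_ : series _ = fun N => mxC (series (fun k => k`!%:R^-1 *: Q ^+ k) N)).
    exact/cvg_mxC.
  by apply/funext => N; exact/esym/mxC_exp_series.
have conjD i j : conjc (spectrum4 lam a b 0 j) = spectrum4 lam a b 0 i ->
    conjc (d 0 j) = d 0 i.
  move=> ij; have [i' Di di] := diagonal_conj Pu MP Qd j.
  by rewrite di; congr (d 0 _); exact: (spectrum4_inj lam1 b0 (etrans (esym Di) ij)).
pose o k : 'I_4 := inord k.
have S k (k4 : (k < 4)%N) : spectrum4 lam a b 0 (o k) =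
    [:: 1; lam%:C; a +i* b; conjc (a +i* b)]`_k by rewrite mxE inordK.
have d0 : d 0 (o 0) = 0.
  have -> : (0 : R[i]) = (ln 1)%:C by rewrite ln1.
  apply: cexp_real_inj => //.
    by apply: conjD; rewrite S//= oppr0.
  by rewrite dE S.
have d1 : d 0 (o 1) = (ln lam)%:C.
  apply: cexp_real_inj => //; first by apply: conjD; rewrite S//= oppr0.
  by rewrite dE S.
have mu0 : a +i* b != 0 by rewrite eq_complex /= (gt_eqF b0) andbF.
have [|k d2] := (cexp_eqP (d 0 (o 2)) mu0).1; first by rewrite dE S.
have d3 : d 0 (o 3) = conjc (d 0 (o 2)).
  by apply/esym/conjD; rewrite !S.
exists k; apply: mxC_inj; rewrite (log_poly_diagonal _ _ Log_diagonalization_pair)//.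
rewrite Qd /Log_of /diag4; congr (_ *m diag_mx _ *m _).
apply/rowP => j; rewrite mxE -[j]inord_val -/(o j).
have jE : nat_of_ord (o j) = j by rewrite /o inordK.
rewrite jE; case: j {jE} => -[|[|[|[|//]]]] lt_j4 /=.
- exact: d0.
- exact: d1.
- exact: d2.
- by rewrite -[LHS]/(d 0 (o 3)) d3 d2.
Qed.

Lemma horner_mx_row_sum0 (p : {poly R}) i : p.[1] = 0 -> \sum_j horner_mx M p i j = 0.
Proof.
move=> p1; have Mu : M *m (const_mx 1 : 'cV_4) = const_mx 1.
  apply/matrixP => k j; rewrite !mxE -[RHS](Mm.2 k).
  by apply: eq_bigr => k' _; rewrite mxE mulr1.
have /matrixP/(_ i 0) := horner_mx_fixed p Mu.
rewrite p1 scale0r !mxE => E; rewrite -[RHS]E.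
by apply: eq_bigr => k _; rewrite mxE mulr1.
Qed.

Lemma spectrum4_nonpos j : ~~ (spectrum4 lam a b 0 j <= 0).
Proof.
case: j => -[|[|[|[|//]]]] lt_j4; rewrite !mxE /= lecE /=.
- by rewrite ler10 andbF.
- by rewrite (lt_geF lam0) andbF.
- by rewrite (lt_eqF b0).
- by rewrite eq_sym oppr_eq0 gt_eqF.
Qed.

Lemma logk0_spectrum4 : \row_j logk 0 (spectrum4 lam a b 0 j) =
  \row_(j < 4) [:: 0; (ln lam)%:C; logk 0 (a +i* b); conjc (logk 0 (a +i* b))]`_j.
Proof.
apply/rowP => -[[|[|[|[|//]]]] lt_j4]; rewrite !mxE.
- by rewrite -[LHS]/(logk 0 1%:C) logk0_real// ln1.
- by rewrite -[LHS]/(logk 0 lam%:C) logk0_real.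
- by [].
- by rewrite -[LHS]/(logk 0 (conjc (a +i* b))) logk0_conj.
Qed.

(** The eigenvalues of a competitor are principal logarithms of eigenvalues of
    M, and exponentiating tells which one belongs to which. *)
Lemma principal_log_Log_of : principal_log (mxC M) (Log_of 0 P lam (a +i* b)).
Proof.
have D0 j : spectrum4 lam a b 0 j != 0.
  by have := spectrum4_nonpos j; apply: contraNN => /eqP ->.
have eM z : eigenvalue (mxC M) z <-> exists j, z = spectrum4 lam a b 0 j.
  by rewrite MP; exact: eigenvalue_diagonalized.
split=> [z /eM[j ->]|]; first exact: spectrum4_nonpos.
rewrite /Log_of /diag4 -logk0_spectrum4; split.
  split.
    by have := expm_Log_of 0; rewrite /Log_of /diag4 -logk0_spectrum4.
  move=> w; split=> [/(eigenvalue_diagonalized _ _ Pu)[j ->]|[z /eM[j -> ->]]].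
    by exists (spectrum4 lam a b 0 j); [apply/eM; exists j|rewrite [LHS]mxE].
  by apply/(eigenvalue_diagonalized _ _ Pu); exists j; rewrite [RHS]mxE.
move=> L [LM Le].
have M0 : mxC M != 0.
  apply: contra markov_neq0 => /eqP h; apply/eqP/mxC_inj; rewrite h.
  by apply/matrixP => i j; rewrite !mxE.
have h := expm_cvg LM M0.
have [d Ld dE] := complex_log_diagonal h.
rewrite Ld; congr (_ *m diag_mx _ *m _); apply/rowP => j; rewrite [LHS]mxE.
have [z zM dz] : exists2 z, eigenvalue (mxC M) z & d 0 j = logk 0 z.
  by apply/Le; rewrite Ld; apply/(eigenvalue_diagonalized _ _ Pu); exists j.
have [i zi] := (eM z).1 zM.
have z0 : z != 0 by rewrite zi.
have : cexp (d 0 j) = z by apply/(cexp_eqP _ z0); exists 0.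
by rewrite dE dz => ->.
Qed.

Variable l : int.
Let Q := horner_mx M (log_poly l lam a b).
Let V := horner_mx M (rot_poly lam a b).
Hypothesis QV : isolated_rate Q V.

Lemma markov_generator_log_poly : markov_generator M Q.
Proof.
split; last exact: expm_log_poly.
have [Qpos _ _] := QV.
split=> [i j ij|i]; first exact: ltW (Qpos _ _ ij).
apply: horner_mx_row_sum0; apply: comb_poly_1; [by rewrite lt_eqF|by rewrite gt_eqF].
Qed.

Lemma unique_markov_generator : unique (markov_generator M) Q.
Proof.
split; first exact: markov_generator_log_poly.
move=> Q' [[Q'0 _] /real_log_is_log_poly[k kE]]; have pi0 := pi_gt0 R.
have [Qpos Vneg Vpos] := QV.
have Q'E i j : Q' i j = Q i j + 2 * pi * (k - l)%:~R * V i j.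
  by rewrite kE (log_polyB k l) rmorphD /= linearZ /= !mxE.
have [kl|kl] := eqVneq k l; first by rewrite kE kl.
exfalso; have [kl0|kl0] : (1 <= k - l) \/ (k - l <= -1) by lia.
(* at this entry 2 pi V < - Q < 0, and the multiple k - l is at least 1 *)
- have [i [j [ij h]]] := Vneg; have := Q'0 _ _ ij; rewrite Q'E.
  have Qij := Qpos _ _ ij; have : 1 <= (k - l)%:~R :> R by rewrite -(@ler_int R) in kl0.
  move: h Qij; set v := V i j; set q := Q i j; set m := (k - l)%:~R => h Qij m1.
  have v0 : 2 * pi * v < 0 by lra.
  apply/negP; rewrite -ltNge; apply: le_lt_trans h; rewrite lerD2l.
  by rewrite mulrAC ler_neMr// ltW.
- have [i [j [ij h]]] := Vpos; have := Q'0 _ _ ij; rewrite Q'E.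
  have Qij := Qpos _ _ ij; have : (k - l)%:~R <= -1 :> R by rewrite -(@ler_int R) in kl0.
  move: h Qij; set v := V i j; set q := Q i j; set m := (k - l)%:~R => h Qij m1.
  have v0 : 0 < 2 * pi * v by lra.
  apply/negP; rewrite -ltNge; apply: le_lt_trans h; rewrite lerD2l.
  by rewrite mulrAC -[leRHS]mulrN1 ler_pM2l.
Qed.

End pointwise.

(** * Spectral data of a Markov matrix from its trace and determinant *)

(** If 1 and lam are eigenvalues of M and a +- i b are the other two, [repart] is
    half their sum, which is a, and [impart2] is their product minus a ^ 2,
    which is b ^ 2. *)
Definition repart (R : realType) (M : 'M[R]_4) (lam : R) : R :=
  (\tr M - 1 - lam) / 2.
Definition impart2 (R : realType) (M : 'M[R]_4) (lam : R) : R :=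
  \det M / lam - repart M lam ^+ 2.

Lemma horner_char_poly (F : comNzRingType) (n : nat) (M : 'M[F]_n) (x : F) :
  (char_poly M).[x] = \det (x%:M - M).
Proof.
rewrite /char_poly -[_.[x]]/(horner_eval x _) -det_map_mx; congr (\det _).
apply/matrixP => i j; rewrite !mxE /= /horner_eval.
by rewrite hornerD hornerN hornerMn hornerX hornerC.
Qed.

(** The row sums being 1, the number 1 is an eigenvalue. What remains after
    division by (X - 1)(X - lam) is a monic quadratic polynomial, which the
    trace and the determinant determine. *)
Lemma char_poly_split (R : realType) (M : 'M[R]_4) (lam : R) :
  (forall i, \sum_j M i j = 1) -> lam != 0 -> lam != 1 -> root (char_poly M) lam ->
  char_poly M = ('X - 1%:P) * ('X - lam%:P) *
    (('X - (repart M lam)%:P) ^+ 2 + (impart2 M lam)%:P).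
Proof.
move=> M1 lam0 lam1 rlam.
have r1 : root (char_poly M) 1.
  rewrite /root horner_char_poly -det_tr; apply/det0P; exists (const_mx 1).
    by apply/eqP => /rowP/(_ 0); rewrite !mxE => /eqP; rewrite oner_eq0.
  apply/rowP => j; rewrite linearB /= tr_scalar_mx mulmxBr mul_mx_scalar scale1r.
  rewrite !mxE -[X in X - _](M1 j) -sumrB big1// => i _.
  by rewrite !mxE mul1r subrr.
have [q1 q1E] := factor_theorem _ _ r1.
have rq1 : root q1 lam.
  move: rlam; rewrite q1E rootM => /orP[//|].
  by rewrite root_XsubC (negPf lam1).
have [q2 q2E] := factor_theorem _ _ rq1.
have pE : char_poly M = ('X - 1%:P) * ('X - lam%:P) * q2.
  by rewrite q1E q2E; ring.
have Xm : ('X - 1%:P) * ('X - lam%:P) \is @monic R.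
  by rewrite monicMl monicXsubC.
have q2m : q2 \is monic.
  by have := char_poly_monic M; rewrite pE monicMl.
have q2s : size q2 = 3.
  have := size_char_poly M; rewrite pE size_monicM ?monic_neq0//.
  by rewrite size_monicM ?monicXsubC ?monic_neq0 ?monicXsubC// !size_XsubC /= => -[].
have q2X : q2 = 'X^2 + q2`_1 *: 'X + (q2`_0)%:P.
  apply/polyP => -[|[|[|i]]]; rewrite !coefE /= ?mulr0 ?mulr1 ?addr0 ?add0r//.
    by move/monicP: q2m; rewrite /lead_coef q2s.
  by rewrite nth_default// q2s.
have tE : q2`_1 = - \tr M + 1 + lam.
  rewrite -(char_poly_trace M)// pE q2X.
  have -> : ('X - 1%:P) * ('X - lam%:P) * ('X^2 + q2`_1 *: 'X + (q2`_0)%:P) =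
    'X^4 + (q2`_1 - 1 - lam) *: 'X^3 + (q2`_0 - (1 + lam) * q2`_1 + lam) *: 'X^2
     + (lam * q2`_1 - (1 + lam) * q2`_0) *: 'X + (lam * q2`_0)%:P.
    rewrite -!mul_polyC !(rmorphB, rmorphD, rmorphM) /=; ring.
  by rewrite !coefE /=; ring.
have dE : q2`_0 = \det M / lam.
  have := char_poly_det M; rewrite -horner_coef0 pE !hornerM !hornerXsubC horner_coef0.
  rewrite !sub0r mulrNN mul1r mulrC -signr_odd expr0 mul1r => h.
  by apply: (mulIf lam0); rewrite mulfVK.
have c1 : q2`_1 = - (2 * repart M lam) by rewrite tE /repart; field.
rewrite pE; congr (_ * _); rewrite q2X c1 dE /impart2 -mul_polyC.
set r := repart M lam; set s := \det M / lam.
by rewrite polyCB polyCN polyCM (rmorphXn polyC) (rmorph_nat polyC) /=; ring.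
Qed.

Lemma diagonalize_spectrum4 (R : realType) (M : 'M[R]_4) (lam a b : R) :
  lam < 1 -> 0 < b ->
  char_poly M = ('X - 1%:P) * ('X - lam%:P) * (('X - a%:P) ^+ 2 + (b ^+ 2)%:P) ->
  exists2 P, P \in unitmx & mxC M = P *m diag_mx (spectrum4 lam a b) *m invmx P.
Proof.
move=> lam1 b0 pE; apply: diagonalize_distinct; first exact: spectrum4_inj.
move=> j; rewrite mxCE -map_char_poly -/(evalC _ _) /root -/(evalC _ _) pE.
rewrite -/(pair_poly a b) evalCM (evalCM ('X - 1%:P)).
rewrite !(evalCD 'X) !evalCN !evalCX !evalCC.
case: j => -[|[|[|[|//]]]] lt_j4; rewrite !mxE /=.
- by rewrite subrr !mul0r.
- by rewrite subrr mulr0 mul0r.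
- by rewrite pair_poly_root mulr0.
- by rewrite -[_ -i* _]/(conjc (a +i* b)) evalC_conj pair_poly_root rmorph0 mulr0.
Qed.

(** * Continuity of the logarithms in M and its real eigenvalue *)

Section continuity.
Context {R : realType} {T : Type} {F : set_system T} {FF : Filter F}.
Variables (n : nat) (M : T -> 'M[R]_n.+1) (M0 : 'M[R]_n.+1).
Hypothesis cM : M @ F --> M0.

(** A form of continuity closed under the ring operations on polynomials, so
    that it can be read off the formulas for [proj1_poly] and the others. *)
Definition cvg_at_mx (p : T -> {poly R}) (p0 : {poly R}) :=
  (fun x => horner_mx (M x) (p x)) @ F --> horner_mx M0 p0.

Lemma cvg_at_mxD p q p0 q0 : cvg_at_mx p p0 -> cvg_at_mx q q0 ->
  cvg_at_mx (fun x => p x + q x) (p0 + q0).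
Proof.
rewrite /cvg_at_mx => hp hq; rewrite rmorphD; under eq_fun do rewrite rmorphD.
exact: cvgD.
Qed.

Lemma cvg_at_mxN p p0 : cvg_at_mx p p0 -> cvg_at_mx (fun x => - p x) (- p0).
Proof.
rewrite /cvg_at_mx => hp; rewrite rmorphN; under eq_fun do rewrite rmorphN.
exact: cvgN.
Qed.

Lemma cvg_at_mxM p q p0 q0 : cvg_at_mx p p0 -> cvg_at_mx q q0 ->
  cvg_at_mx (fun x => p x * q x) (p0 * q0).
Proof.
rewrite /cvg_at_mx => hp hq; rewrite rmorphM; under eq_fun do rewrite rmorphM.
exact: cvg_mulmx.
Qed.

Lemma cvg_at_mxC (c : T -> R) (c0 : R) : c @ F --> c0 ->
  cvg_at_mx (fun x => (c x)%:P) c0%:P.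
Proof.
rewrite /cvg_at_mx => hc; rewrite horner_mx_C; under eq_fun do rewrite horner_mx_C.
apply/cvg_mxP => i j; rewrite mxE; under eq_fun do rewrite mxE.
exact: cvgMn.
Qed.

Lemma cvg_at_mxX : cvg_at_mx (fun=> 'X) 'X.
Proof. by rewrite /cvg_at_mx horner_mx_X; under eq_fun do rewrite horner_mx_X. Qed.

Lemma cvg_at_mxZ (c : T -> R) (c0 : R) p p0 : c @ F --> c0 -> cvg_at_mx p p0 ->
  cvg_at_mx (fun x => c x *: p x) (c0 *: p0).
Proof.
move=> hc hp; rewrite -mul_polyC.
rewrite (_ : (fun x => _) = fun x => (c x)%:P * p x).
  by apply: cvg_at_mxM => //; exact: cvg_at_mxC.
by apply/funext => x; rewrite mul_polyC.
Qed.

Variables (lam a b : T -> R) (lam0 a0 b0 : R).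
Hypotheses (clam : lam @ F --> lam0) (ca : a @ F --> a0) (cb : b @ F --> b0).
Hypotheses (lam0_gt0 : 0 < lam0) (lam0_lt1 : lam0 < 1) (b0_gt0 : 0 < b0).

Let pair_poly_neq0 x : (pair_poly a0 b0).[x] != 0.
Proof. by rewrite gt_eqF// pair_poly_gt0// gt_eqF. Qed.

Lemma cvg_at_mx_pair_poly : cvg_at_mx (fun x => pair_poly (a x) (b x)) (pair_poly a0 b0).
Proof.
rewrite /pair_poly; apply: cvg_at_mxD.
  rewrite expr2; under eq_fun do rewrite expr2.
  by apply: cvg_at_mxM; apply: cvg_at_mxD; [exact: cvg_at_mxX| |exact: cvg_at_mxX|];
    apply: cvg_at_mxN; apply: cvg_at_mxC.
by apply: cvg_at_mxC; rewrite expr2; under eq_fun do rewrite expr2; apply: cvgM.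
Qed.

Lemma cvg_horner_pair_poly (c : T -> R) (c0 : R) : c @ F --> c0 ->
  (fun x => (pair_poly (a x) (b x)).[c x]) @ F --> (pair_poly a0 b0).[c0].
Proof.
move=> cc; have E u v w : (pair_poly u v).[w] = (w - u) * (w - u) + v * v :> R.
  by rewrite /pair_poly !hornerE !expr2.
rewrite E; under eq_fun do rewrite E.
by apply: cvgD; apply: cvgM => //; apply: cvgB.
Qed.

Lemma cvg_at_mx_proj1_poly :
  cvg_at_mx (fun x => proj1_poly (lam x) (a x) (b x)) (proj1_poly lam0 a0 b0).
Proof.
apply: cvg_at_mxZ.
  apply: cvgV.
    by rewrite mulf_neq0 ?pair_poly_neq0// subr_eq0 gt_eqF.
  apply: cvgM; first by apply: cvgB => //; exact: cvg_cst.
  by apply: cvg_horner_pair_poly; exact: cvg_cst.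
apply: cvg_at_mxM; last exact: cvg_at_mx_pair_poly.
by apply: cvg_at_mxD; [exact: cvg_at_mxX|apply: cvg_at_mxN; exact: cvg_at_mxC].
Qed.

Lemma cvg_at_mx_projlam_poly :
  cvg_at_mx (fun x => projlam_poly (lam x) (a x) (b x)) (projlam_poly lam0 a0 b0).
Proof.
apply: cvg_at_mxZ.
  apply: cvgV.
    by rewrite mulf_neq0 ?pair_poly_neq0// subr_eq0 lt_eqF.
  by apply: cvgM; [apply: cvgB => //; exact: cvg_cst|exact: cvg_horner_pair_poly].
apply: cvg_at_mxM; last exact: cvg_at_mx_pair_poly.
apply: cvg_at_mxD; [exact: cvg_at_mxX|apply: cvg_at_mxN; apply: cvg_at_mxC].
exact: cvg_cst.
Qed.

Lemma cvg_at_mx_projpair_poly :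
  cvg_at_mx (fun x => projpair_poly (lam x) (a x) (b x)) (projpair_poly lam0 a0 b0).
Proof.
apply: cvg_at_mxD; last exact/cvg_at_mxN/cvg_at_mx_projlam_poly.
apply: cvg_at_mxD; last exact/cvg_at_mxN/cvg_at_mx_proj1_poly.
by apply: cvg_at_mxC; exact: cvg_cst.
Qed.

Lemma cvg_at_mx_rot_poly :
  cvg_at_mx (fun x => rot_poly (lam x) (a x) (b x)) (rot_poly lam0 a0 b0).
Proof.
apply: cvg_at_mxZ; first by apply: cvgV => //; rewrite gt_eqF.
apply: cvg_at_mxM; last exact: cvg_at_mx_projpair_poly.
by apply: cvg_at_mxD; [exact: cvg_at_mxX|apply: cvg_at_mxN; exact: cvg_at_mxC].
Qed.

Lemma cvg_at_mx_log_poly l :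
  cvg_at_mx (fun x => log_poly l (lam x) (a x) (b x)) (log_poly l lam0 a0 b0).
Proof.
have r0 : 0 < a0 ^+ 2 + b0 ^+ 2 by rewrite ltr_wpDl ?sqr_ge0// exprn_gt0.
have cr : (fun x => Num.sqrt (a x ^+ 2 + b x ^+ 2)) @ F --> Num.sqrt (a0 ^+ 2 + b0 ^+ 2).
  apply: continuous_cvg; first exact: sqrt_continuous.
  by rewrite !expr2; under eq_fun do rewrite !expr2; apply: cvgD; apply: cvgM.
have s0 : 0 < Num.sqrt (a0 ^+ 2 + b0 ^+ 2) by rewrite sqrtr_gt0.
apply: cvg_at_mxD; first apply: cvg_at_mxD.
- apply: cvg_at_mxZ; last exact: cvg_at_mx_projlam_poly.
  by apply: continuous_cvg => //; exact: continuous_ln.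
- apply: cvg_at_mxZ; last exact: cvg_at_mx_projpair_poly.
  by apply: continuous_cvg => //; exact: continuous_ln.
apply: cvg_at_mxZ; last exact: cvg_at_mx_rot_poly.
apply: cvgD; last exact: cvg_cst.
apply: continuous_cvg.
  apply: continuous_acos; rewrite -ltr_norml normrM normfV (gtr0_norm s0).
  rewrite ltr_pdivrMr// mul1r -sqrtr_sqr ltr_sqrt// ltrDl exprn_gt0//.
by apply: cvgM => //; apply: cvgV => //; rewrite gt_eqF.
Qed.

End continuity.

(** * Stability of an isolated logarithm *)

Section spectrum4_invariants.
Variables (R : realType) (M : 'M[R]_4) (P : 'M[R[i]]_4) (lam a b : R).
Hypothesis MP : mxC M = P *m diag_mx (spectrum4 lam a b) *m invmx P.
Hypothesis Pu : P \in unitmx.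

Lemma char_poly_spectrum4 (x : R) :
  (char_poly M).[x] = (x - 1) * (x - lam) * (pair_poly a b).[x].
Proof.
apply: (@complexI R); rewrite horner_char_poly -det_map_mx.
have -> : map_mx (real_complex R) (x%:M - M) =
    P *m (x%:C%:M - diag_mx (spectrum4 lam a b)) *m invmx P.
  rewrite map_mxB map_scalar_mx -mxCE MP mulmxBr mulmxBl; congr (_ - _).
  by rewrite scalar_mxC -mulmxA mulmxV// mulmx1.
rewrite !det_mulmx det_inv mulrAC mulfV ?mul1r -?unitfE -?unitmxE//.
rewrite -diag_const_mx -raddfB det_diag !big_ord_recl big_ord0 !mxE /=.
rewrite /pair_poly !hornerE /=; simpc; congr (_ +i* _); ring.
Qed.

Lemma repart_spectrum4 : repart M lam = a.
Proof.
have : \tr M = 1 + lam + 2 * a.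
  apply: (@complexI R); rewrite -[LHS]/((real_complex R) _) -trace_map_mx -mxCE MP.
  rewrite mxtrace_mulC mulmxA mulVmx// mul1mx mxtrace_diag.
  by rewrite !big_ord_recl big_ord0 !mxE /=; simpc; congr (_ +i* _); ring.
by rewrite /repart => ->; field.
Qed.

Lemma impart2_spectrum4 : lam != 0 -> impart2 M lam = b ^+ 2.
Proof.
move=> lam0; have : \det M = lam * (a ^+ 2 + b ^+ 2).
  have := char_poly_spectrum4 0; rewrite horner_char_poly raddf0 sub0r.
  by rewrite -scaleN1r detZ expr2 /pair_poly !hornerE /=; lra.
by rewrite /impart2 repart_spectrum4 => ->; field.
Qed.

End spectrum4_invariants.

(** A change of sign of the characteristic polynomial between x1 and x2 is an
    open condition on M. *)
Lemma near_char_poly_root (R : realType) (n : nat) (M0 : 'M[R]_n) (x1 x2 : R) :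
  x1 <= x2 -> (char_poly M0).[x1] * (char_poly M0).[x2] < 0 ->
  \forall M \near M0, exists2 lam, x1 < lam < x2 & root (char_poly M) lam.
Proof.
move=> x12 h0.
have c x : (fun M : 'M[R]_n => (char_poly M).[x]) @ nbhs M0 --> (char_poly M0).[x].
  rewrite horner_char_poly; under eq_fun do rewrite horner_char_poly.
  by apply: cvg_det; apply: cvgB; [exact: cvg_cst|exact: cvg_id].
have FF : Filter (nbhs M0) by exact: nbhs_filter.
have cc := @cvgM _ _ _ FF _ _ _ _ (c x1) (c x2).
have := @cvgr_lt _ _ _ FF _ _ cc _ h0; apply: filterS => M h.
by have [lam /[!in_itv] /= lam12 r] := polyrcf.poly_ivtoo x12 h; exists lam.
Qed.

Lemma near_isolated_rate (R : realType) (T : Type) (F : set_system T) {FF : Filter F}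
    (n : nat) (Q V : T -> 'M[R]_n) (Q0 V0 : 'M[R]_n) :
  Q @ F --> Q0 -> V @ F --> V0 -> isolated_rate Q0 V0 ->
  \forall x \near F, isolated_rate (Q x) (V x).
Proof.
move=> /cvg_mxP cQ /cvg_mxP cV [Q0p [i1 [j1 [ij1 h1]]] [i2 [j2 [ij2 h2]]]].
have cV2 i j : (fun x => 2 * pi * V x i j) @ F --> 2 * pi * V0 i j.
  by apply: cvgM; [exact: cvg_cst|exact: cV].
have nQ : \forall x \near F, forall i j, i != j -> 0 < Q x i j.
  apply: filter_forall => i; apply: filter_forall => j.
  have [ij|ij] := boolP (i != j).
    by apply: filterS (cvgr_gt _ (cQ i j) _ (Q0p i j ij)) => x h _.
  exact: filterE.
have n1 := cvgr_lt _ (cvgD (cQ i1 j1) (cV2 i1 j1)) _ h1.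
have n2 := cvgr_lt _ (cvgB (cQ i2 j2) (cV2 i2 j2)) _ h2.
near=> x; split; first by near: x.
  by exists i1, j1; split => //; near: x; exact: n1.
by exists i2, j2; split => //; near: x; exact: n2.
Unshelve. all: by end_near. Qed.

Definition isolated_log (R : realType) (l : int) (M : 'M[R]_4) : Prop :=
  exists P lam a b, [/\ P \in unitmx, 0 < lam < 1, 0 < b,
    mxC M = P *m diag_mx (spectrum4 lam a b) *m invmx P &
    isolated_rate (horner_mx M (log_poly l lam a b)) (horner_mx M (rot_poly lam a b))].

(** The inequalities hold for all pairs (M, lam) near (M0, lam0), the numbers a
    and b being computed from M and lam. Choosing an interval around lam0 inside
    the range allowed for lam, where the characteristic polynomial of M0
    changes sign, yields for M near M0 a root lam of its characteristic
    polynomial within that range. *)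
Lemma near_isolated_log (R : realType) (l : int) (M0 : 'M[R]_4) :
  isolated_log l M0 -> \forall M \near M0, markov_matrix M -> isolated_log l M.
Proof.
move=> [P [lam0 [a0 [b0 [Pu /andP[lam0_gt0 lam0_lt1] b0_gt0 MP sep]]]]].
have lam0n : lam0 != 0 by rewrite gt_eqF.
pose F := nbhs ((M0, lam0) : 'M[R]_4 * R).
have cM : (fun x : 'M[R]_4 * R => x.1) @ F --> M0 by exact: cvg_fst.
have clam : (fun x : 'M[R]_4 * R => x.2) @ F --> lam0 by exact: cvg_snd.
have ca : (fun x : 'M[R]_4 * R => repart x.1 x.2) @ F --> a0.
  rewrite -(repart_spectrum4 MP Pu); apply: cvgM; last exact: cvg_cst.
  apply: cvgB => //; apply: cvgB; last exact: cvg_cst.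
  exact: cvg_mxtrace.
have cb2 : (fun x : 'M[R]_4 * R => impart2 x.1 x.2) @ F --> b0 ^+ 2.
  rewrite -(impart2_spectrum4 MP Pu lam0n) /impart2.
  rewrite -(repart_spectrum4 MP Pu) in ca.
  apply: cvgB; last by rewrite expr2; under eq_fun do rewrite expr2; apply: cvgM.
  apply: cvgM; first exact: cvg_det.
  exact: cvgV.
have cb : (fun x : 'M[R]_4 * R => Num.sqrt (impart2 x.1 x.2)) @ F --> b0.
  rewrite -[X in _ --> X](ger0_norm (ltW b0_gt0)) -sqrtr_sqr.
  by apply: continuous_cvg => //; exact: sqrt_continuous.
have sepN := near_isolated_rate
  (cvg_at_mx_log_poly (l := l) cM clam ca cb lam0_gt0 lam0_lt1 b0_gt0)
  (cvg_at_mx_rot_poly cM clam ca cb lam0_lt1 b0_gt0) sep.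
pose good (M : 'M[R]_4) lam := [/\ 0 < impart2 M lam, 0 < lam < 1 &
  isolated_rate
    (horner_mx M (log_poly l lam (repart M lam) (Num.sqrt (impart2 M lam))))
    (horner_mx M (rot_poly lam (repart M lam) (Num.sqrt (impart2 M lam))))].
have : \forall x \near F, good x.1 x.2.
  have n1 : \forall x \near F, 0 < impart2 x.1 x.2.
    by apply: (cvgr_gt _ cb2); rewrite exprn_gt0.
  have n2 : \forall x \near F, 0 < x.2 by exact: (cvgr_gt _ clam).
  have n3 : \forall x \near F, x.2 < 1 by exact: (cvgr_lt _ clam).
  near=> x; split; [by near: x| |near: x; exact: sepN].
  by apply/andP; split; near: x.
move=> -[[A B] /= [nA nB] AB].
move/nbhs_ballP: nB => [e /= e0 eB].
(* the interval around lam0 has to avoid the root 1 as well *)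
pose d := Num.min (e / 2) ((1 - lam0) / 2).
have d0 : 0 < d by rewrite lt_min !divr_gt0// subr_gt0.
have de : d < e by rewrite gt_min; apply/orP; left; lra.
have d1 : d < 1 - lam0 by rewrite gt_min; apply/orP; right; lra.
have : (char_poly M0).[lam0 - d] * (char_poly M0).[lam0 + d] < 0.
  rewrite !(char_poly_spectrum4 MP Pu).
  have p1 : 0 < (pair_poly a0 b0).[lam0 - d] by rewrite pair_poly_gt0 ?gt_eqF.
  have p2 : 0 < (pair_poly a0 b0).[lam0 + d] by rewrite pair_poly_gt0 ?gt_eqF.
  set w1 := (pair_poly _ _).[_] in p1 *; set w2 := (pair_poly _ _).[_] in p2 *.
  rewrite (_ : _ * _ =
    - (d ^+ 2 * ((lam0 - d - 1) * (lam0 + d - 1)) * (w1 * w2))); last by ring.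
  rewrite oppr_lt0 mulr_gt0 ?(mulr_gt0 p1 p2)// mulr_gt0 ?exprn_gt0//.
  by rewrite nmulr_rgt0; lra.
have dd : lam0 - d <= lam0 + d by rewrite lerD2l; lra.
move=> /(near_char_poly_root dd) nroot.
near=> M => Mm.
have AM : A M by near: M.
have [lam /andP[l1 l2] rlam] :
    exists2 lam, lam0 - d < lam < lam0 + d & root (char_poly M) lam.
  by near: M.
have [i0 lam01 sepM] : good M lam.
  apply: (AB (M, lam)); split => //=; apply: eB; rewrite /ball /= ltr_norml; lra.
have /andP[lam_gt0 lam_lt1] := lam01.
have pE := char_poly_split Mm.2 (lt0r_neq0 lam_gt0) (negbT (lt_eqF lam_lt1)) rlam.
have s0 : 0 < Num.sqrt (impart2 M lam) by rewrite sqrtr_gt0.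
have [|P' P'u MP'] := diagonalize_spectrum4 (M := M) (a := repart M lam) lam_lt1 s0.
  by rewrite sqr_sqrtr// ltW.
by exists P', lam, (repart M lam), (Num.sqrt (impart2 M lam)).
Unshelve. all: by end_near. Qed.

(** * A rate matrix on the 4-cycle with rates 1, 5, 1, 5 *)

Definition mx4 (K : nzRingType) (rows : seq (seq K)) : 'M[K]_4 :=
  \matrix_(i, j) (nth [::] rows i)`_j.

Lemma ord4P (P : 'I_4 -> Prop) :
  P (@Ordinal 4 0 isT) -> P (@Ordinal 4 1 isT) -> P (@Ordinal 4 2 isT) ->
  P (@Ordinal 4 3 isT) -> forall i, P i.
Proof.
by move=> P0 P1 P2 P3 [[|[|[|[|//]]]] lt_i4]; rewrite (bool_irrelevance lt_i4 isT).
Qed.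

(** The real normal form with eigenvalues c, x and u +- i t. *)
Definition rot_block (K : nzRingType) (c x u t : K) : 'M[K]_4 :=
  mx4 [:: [:: c; 0; 0; 0]; [:: 0; x; 0; 0]; [:: 0; 0; u; t]; [:: 0; 0; - t; u]].

Section rot_block_complex.
Variable R : realType.

Definition rot_basis : 'M[R[i]]_4 :=
  mx4 [:: [:: 1; 0; 0; 0]; [:: 0; 1; 0; 0]; [:: 0; 0; 1; 1]; [:: 0; 0; 'i; - 'i]].

Definition rot_cobasis : 'M[R[i]]_4 :=
  mx4 [:: [:: 1; 0; 0; 0]; [:: 0; 1; 0; 0];
          [:: 0; 0; 2^-1; - 'i / 2]; [:: 0; 0; 2^-1; 'i / 2]].

Lemma rot_cobasisK : rot_cobasis *m rot_basis = 1%:M.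
Proof.
have i2 : 'i * 'i = - 1 :> R[i] by rewrite -expr2 sqr_i.
apply/matrixP; elim/ord4P; elim/ord4P; rewrite !mxE !big_ord_recl big_ord0 !mxE /=;
  rewrite ?(mul0r, mulr0, mul1r, mulr1, addr0, add0r)//.
- rewrite mulrAC mulNr i2 opprK mul1r -mulr2n -(mulr_natr 2^-1) mulVf// pnatr_eq0//.
- by rewrite mulrN mulrAC mulNr i2 opprK mul1r subrr.
- by rewrite mulrAC i2 mulN1r subrr.
- rewrite mulrN mulrAC i2 mulN1r opprK -mulr2n -(mulr_natr 2^-1) mulVf// pnatr_eq0//.
Qed.

Lemma rot_block_diag (c x u t : R) :
  mxC (rot_block c x u t) *m rot_basis =
  rot_basis *m diag4 c%:C x%:C (u +i* t) (conjc (u +i* t)).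
Proof.
rewrite /diag4 mul_mx_diag.
apply/matrixP; elim/ord4P; elim/ord4P; rewrite !mxE !big_ord_recl big_ord0 !mxE /=;
  rewrite ?(mul0r, mulr0, mul1r, mulr1, addr0, add0r)//; simpc => //.
Qed.
End rot_block_complex.

Section cycle.
Variables (R : realType) (s : R).
Hypothesis sE : s = 1 \/ s = - 1.

(** Right eigenvectors of the rate matrix of the 4-cycle 0 -> 1 -> 2 -> 3 -> 0
    with rates 1, 5, 1, 5, for the eigenvalues 0 and -6, and the real and
    imaginary parts of an eigenvector for -3 + s i. The sign s, which is 1
    or -1, chooses between the two conjugate eigenvalues: it serves to make the
    chosen logarithm of the eigenvalue with positive imaginary part have a
    positive or a negative imaginary part. *)
Definition cycle_basis : 'M[R]_4 :=
  mx4 [:: [:: 1; 1; 1; 0]; [:: 1; - 5; - 2; s]; [:: 1; 1; - 1; 0]; [:: 1; - 5; 2; - s]].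

Definition cycle_cobasis : 'M[R]_4 :=
  mx4 [:: [:: 5 / 12; 1 / 12; 5 / 12; 1 / 12];
          [:: 1 / 12; - (1 / 12); 1 / 12; - (1 / 12)];
          [:: 1 / 2; 0; - (1 / 2); 0];
          [:: s; s / 2; - s; - (s / 2)]].

Definition cycle_comb (c x u t : R) : 'M[R]_4 :=
  cycle_basis *m rot_block c x u t *m cycle_cobasis.

Lemma cycle_cobasisK : cycle_cobasis *m cycle_basis = 1%:M.
Proof.
apply/matrixP; elim/ord4P; elim/ord4P; rewrite !mxE !big_ord_recl big_ord0 !mxE /=;
  case: sE => sE1; rewrite ?sE1; lra.
Qed.

Lemma cycle_combE c x u t : cycle_comb c x u (s * t) =
  mx4 (let p := (5 * c + x) / 12 in let q := (c - x) / 12 in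
       let p' := 5 * (c - x) / 12 in let q' := (c + 5 * x) / 12 in
    [:: [:: p + u / 2 + t; q + t / 2; p - u / 2 - t; q - t / 2];
        [:: p' - 5 / 2 * t; q' + u / 2 - t; p' + 5 / 2 * t; q' - u / 2 + t];
        [:: p - u / 2 - t; q - t / 2; p + u / 2 + t; q + t / 2];
        [:: p' + 5 / 2 * t; q' - u / 2 + t; p' - 5 / 2 * t; q' + u / 2 - t]]).
Proof.
apply/matrixP; elim/ord4P; elim/ord4P;
  rewrite !mxE !big_ord_recl big_ord0 !mxE !big_ord_recl !big_ord0 !mxE /=;
  case: sE => sE1; rewrite ?sE1; lra.
Qed.

Definition cycle_eigenvectors : 'M[R[i]]_4 := mxC cycle_basis *m rot_basis R.

Lemma cycle_eigenvectors_unit : cycle_eigenvectors \in unitmx.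
Proof.
have [_ Bu] := mulmx1_unit cycle_cobasisK.
have [_ Ku] := mulmx1_unit (rot_cobasisK R).
by rewrite unitmx_mul Ku andbT mxCE map_unitmx.
Qed.

Lemma cycle_comb_diag (c x u t : R) :
  mxC (cycle_comb c x u t) = cycle_eigenvectors *m
    diag4 c%:C x%:C (u +i* t) (conjc (u +i* t)) *m invmx cycle_eigenvectors.
Proof.
apply: (canRL (mulmxK cycle_eigenvectors_unit)).
rewrite /cycle_comb /cycle_eigenvectors mulmxA !mxCE !map_mxM -!mulmxA.
rewrite [map_mx _ cycle_cobasis *m _]mulmxA -map_mxM cycle_cobasisK map_mx1 mul1mx.
by rewrite -rot_block_diag.
Qed.

(** Both sides have the same eigenvectors and, by [comb_poly_spectrum], the same
    eigenvalues. *)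
Lemma horner_cycle_comb (lam b x u t : R) : lam < 1 -> 0 < b ->
  horner_mx (cycle_comb 1 lam 0 b) (comb_poly lam 0 b x u t) = cycle_comb 0 x u t.
Proof.
move=> lam1 b0; apply: mxC_inj.
have l1 : lam != 1 by rewrite lt_eqF.
have bn : b != 0 by rewrite gt_eqF.
rewrite (mxC_horner _ cycle_eigenvectors_unit (cycle_comb_diag 1 lam 0 b)).
by rewrite (comb_poly_spectrum 0 l1 bn) cycle_comb_diag.
Qed.

(** The first matrix is t Q0 + 3 (E - 1) and the second one is V, up to the sign
    s; the witnesses are the pairs of states at distance two on the cycle. *)
Lemma cycle_comb_isolated (t : R) : 1 <= t ->
  isolated_rate (cycle_comb 0 (- (6 * t + 3)) (- (3 * t + 3)) (s * t))
    (cycle_comb 0 0 0 1).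
Proof.
move=> t1; have pi2 := pi_ge2 R.
have ss : 1 = s * s by case: sE => ->; ring.
rewrite [cycle_comb 0 0 0 1](congr1 (cycle_comb 0 0 0) ss) !cycle_combE; split.
- by elim/ord4P; elim/ord4P => //= _; rewrite !mxE /=; lra.
- case: sE => ->.
    by exists (@Ordinal 4 0 isT), (@Ordinal 4 2 isT); split => //; rewrite !mxE /=; lra.
  by exists (@Ordinal 4 1 isT), (@Ordinal 4 3 isT); split => //; rewrite !mxE /=; lra.
- case: sE => ->.
    by exists (@Ordinal 4 1 isT), (@Ordinal 4 3 isT); split => //; rewrite !mxE /=; lra.
  by exists (@Ordinal 4 0 isT), (@Ordinal 4 2 isT); split => //; rewrite !mxE /=; lra.
Qed.

(** The stationary distribution (5, 1, 5, 1) / 12 has entries at least 1 / 12,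
    which dominate the two other terms once b is small. *)
Lemma cycle_comb_markov (lam b : R) : 0 < lam <= b -> b <= 1 / 64 ->
  markov_matrix (cycle_comb 1 lam 0 b).
Proof.
move=> /andP[lam0 lamb] b64.
have -> : b = s * (s * b) by case: sE => ->; ring.
rewrite cycle_combE; split.
  by case: sE => sE1; elim/ord4P; elim/ord4P; rewrite !mxE /= ?sE1; lra.
by elim/ord4P; rewrite !big_ord_recl big_ord0 !mxE /=; lra.
Qed.

End cycle.

Lemma expR_le64 (R : realType) (x : R) : 6 <= x -> expR (- x) <= 1 / 64.
Proof.
move=> x6; rewrite expRN mul1r lef_pV2 ?posrE ?expR_gt0//.
have e2 : 2 <= expR 1 :> R by have := expR_ge1Dx (1 : R); lra.
apply: (@le_trans _ _ (expR 6)); last by rewrite ler_expR.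
have -> : expR 6 = expR 1 ^+ 6 :> R by rewrite -expRM_natr mul1r.
have -> : 64 = 2 ^+ 6 :> R by rewrite -natrX.
by rewrite lerXn2r ?nnegrE ?expR_ge0.
Qed.

(** The pair of eigenvalues of the Markov matrix is i b and - i b, of argument
    pi / 2, so that its l-th logarithm has imaginary part pi / 2 + 2 pi l, which
    is s t; its eigenvalues are exp of -(6 t + 3) and -(3 t + 3) +- i t. *)
Lemma exists_isolated_log (R : realType) (l : int) :
  exists2 M : 'M[R]_4, markov_matrix M & isolated_log l M.
Proof.
have pi2 := pi_ge2 R.
pose th : R := pi / 2 + 2 * pi * l%:~R.
have [s [t [sE t1 thE]]] : exists s t : R, [/\ s = 1 \/ s = - 1, 1 <= t & th = s * t].
  have [l0|l0] := lerP 0 l.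
    have : 0 <= l%:~R :> R by rewrite ler0z.
    move=> h; exists 1, th; split; [by left| |by rewrite mul1r].
    have : 0 <= pi * l%:~R :> R by rewrite mulr_ge0//; lra.
    by rewrite /th; lra.
  have : l%:~R <= -1 :> R by rewrite -[-1](rmorphN1 (@intmul R 1)) ler_int; lia.
  move=> h; exists (- 1), (- th); split; [by right| |by rewrite mulN1r opprK].
  have : pi * l%:~R <= pi * -1 :> R by rewrite ler_pM2l// pi_gt0.
  by rewrite /th; lra.
pose lam : R := expR (- (6 * t + 3)); pose b : R := expR (- (3 * t + 3)).
have lam0 : 0 < lam by exact: expR_gt0.
have b0 : 0 < b by exact: expR_gt0.
have lamb : lam <= b by rewrite ler_expR; lra.
have b64 : b <= 1 / 64 by apply: expR_le64; lra.
have lam1 : lam < 1 by lra.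
exists (cycle_comb s 1 lam 0 b); first by apply: (cycle_comb_markov sE); rewrite ?lam0.
exists (cycle_eigenvectors s), lam, 0, b; split => //.
- exact: cycle_eigenvectors_unit.
- by rewrite lam0.
- exact: cycle_comb_diag sE _ _ _ _.
have -> : log_poly l lam 0 b = comb_poly lam 0 b (- (6 * t + 3)) (- (3 * t + 3)) (s * t).
  rewrite /log_poly expr0n add0r sqrtr_sqr gtr0_norm// mul0r acos0 /lam /b !expRK.
  by rewrite -thE.
have -> : rot_poly lam 0 b = comb_poly lam 0 b 0 0 1.
  by rewrite /comb_poly !scale0r !add0r scale1r.
rewrite !(horner_cycle_comb sE)//.
exact: cycle_comb_isolated.
Qed.

(** * Open sets of Markov matrices with a unique generator *)

Section isolated_log_markov.
Variables (R : realType) (l : int) (M : 'M[R]_4).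
Hypotheses (Mm : markov_matrix M) (Mgood : isolated_log l M).

Lemma isolated_log_generator :
  [/\ embeddable M, Log_defined M &
      exists Q : 'M[R]_4, mxC Q = Log l M /\ unique (markov_generator M) Q].
Proof.
have [P [lam [a [b [Pu /andP[lam0 lam1] b0 MP sep]]]]] := Mgood.
have LD := Log_diagonalization_pair lam0 lam1 b0 MP Pu.
have U := unique_markov_generator Mm lam0 lam1 b0 MP Pu sep.
split.
- by split => //; exists (horner_mx M (log_poly l lam a b)); exact: U.1.
- by split => //; exists P, lam, (a +i* b).
- exists (horner_mx M (log_poly l lam a b)); split => //.
  by rewrite (Log_ofE _ LD); exact: log_poly_diagonal.
Qed.

(** Were Log_0(M) a rate matrix, it would be a second generator, as it differs
    from Log_l(M) by a nonzero multiple of V. *)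
Lemma isolated_log_principal : l != 0 ->
  exists L : 'M[R[i]]_4, principal_log (mxC M) L /\
    ~ (exists Q : 'M[R]_4, rate_matrix Q /\ L = mxC Q).
Proof.
move=> l0; have [P [lam [a [b [Pu /andP[lam0 lam1] b0 MP sep]]]]] := Mgood.
have LD := Log_diagonalization_pair lam0 lam1 b0 MP Pu.
have U := unique_markov_generator Mm lam0 lam1 b0 MP Pu sep.
exists (Log_of 0 P lam (a +i* b)); split; first exact: principal_log_Log_of.
move=> [Q [Qrate LQ]].
have QE : Q = horner_mx M (log_poly 0 lam a b).
  by apply: mxC_inj; rewrite -LQ (log_poly_diagonal _ b0 LD).
have /U.2 : markov_generator M Q.
  by split=> //; rewrite QE; exact: expm_log_poly lam0 lam1 b0 MP Pu 0.
rewrite QE (log_polyB l 0) rmorphD /= linearZ /= => /eqP.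
rewrite -subr_eq0 addrAC subrr add0r subr0 => /eqP rot0.
have [Qpos [i [j [ij h]]] _] := sep.
have pil : 2 * pi * l%:~R != 0 :> R.
  by rewrite mulf_neq0 ?intr_eq0// mulf_neq0 ?pnatr_eq0// gt_eqF// pi_gt0.
move/eqP: rot0; rewrite scaler_eq0 (negPf pil) /= => /eqP rot0.
move: h; rewrite rot0 mxE mulr0 addr0 ltNge => /negP[].
exact: ltW (Qpos _ _ ij).
Qed.

End isolated_log_markov.

(** The open set is the interior, among all matrices, of the condition that M
    has an isolated l-th logarithm provided that it is a Markov matrix. *)
Lemma exists_markov_open_isolated_log (R : realType) (l : int) :
  exists U : set 'M[R]_4, [/\ markov_open U, U !=set0 &
    forall M, U M -> markov_matrix M /\ isolated_log l M].
Proof.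
pose G := [set M : 'M[R]_4 | markov_matrix M -> isolated_log l M].
exists (G° `&` @markov_matrix R 4); split.
- by exists G° => //; exact: open_interior.
- have [M0 M0m M0g] := exists_isolated_log R l.
  by exists M0; split => //; exact: near_isolated_log M0g.
- by move=> M [/interior_subset GM Mm]; split => //; exact: GM.
Qed.

Theorem theorem3p3 (R : realType) :
  (forall l : int, exists U : set 'M[R]_4,
     [/\ markov_open U,
         U !=set0 &
         forall M : 'M[R]_4, U M ->
           [/\ embeddable M,
               Log_defined M &
               exists Q : 'M[R]_4,
                 mxC Q = Log l M /\ unique (markov_generator M) Q]])
  /\
  (exists U : set 'M[R]_4,
     [/\ markov_open U,
         U !=set0 &
         forall M : 'M[R]_4, U M ->
           embeddable M /\
           exists L : 'M[R[i]]_4,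
             principal_log (mxC M) L /\
             ~ (exists Q : 'M[R]_4, rate_matrix Q /\ L = mxC Q)]).
Proof.
split=> [l|].
  have [U [oU U0 UM]] := exists_markov_open_isolated_log R l.
  by exists U; split => // M /UM[Mm Mg]; exact: isolated_log_generator Mm Mg.
have [U [oU U0 UM]] := exists_markov_open_isolated_log R 1.
exists U; split => // M /UM[Mm Mg].
split; first by have [] := isolated_log_generator Mm Mg.
exact: (isolated_log_principal Mm Mg).
Qed.
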